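(* Let $(\Delta,\mathbf{L})$ be a simple compact convex labelled polytope in $\mathbb{R}^m$ which contains the origin, and let $f$ be an affine linear function which is positive on $\Delta$. Let $(\tilde\Delta,\tilde{\mathbf{L}})$ be the $f$-twist transform of $(\Delta,\mathbf{L})$. Then for every continuous function $\phi$ on $\Delta$, with $\tilde\phi$ the function on $\tilde\Delta$ given by $\tilde\phi(\tilde x)=\frac{\phi(x)}{f(x)}$ for $\tilde x=\frac{x}{f(x)}$, $$\mathcal{F}_{\Delta,\mathbf{L},f,m+2}(\phi)=\frac{1}{f(0)}\,\mathcal{F}_{\tilde\Delta,\tilde{\mathbf{L}}}(\tilde\phi),$$ where the associated affine linear functions are related by $$\zeta_{(\tilde\Delta,\tilde{\mathbf{L}})}(\tilde x)=\frac{\zeta_{(\Delta,\mathbf{L},f,m+2)}(x)}{f(x)}.$$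
   Context: **Labelled polytopes.** A labelled (simple, compact, convex) polytope $(\Delta,\mathbf{L})$ in $\mathbb{R}^m$ is a compact convex simple polytope $\Delta$ with non-empty interior and $d$ facets $F_1,\dots,F_d$, together with a set $\mathbf{L}=\{L_1,\dots,L_d\}$ of affine linear functions such that $\Delta=\{x\in\mathbb{R}^m: L_i(x)\ge 0,\ i=1,\dots,d\}$ and $F_i=\Delta\cap\{L_i=0\}$. No integrality of the $dL_i$ is assumed. **$f$-twist.** Assume $0\in\Delta$ and $f$ is affine linear and positive on $\Delta$. Put $T(x)=\tilde x=x/f(x)$. The $f$-twist transform of $(\Delta,\mathbf{L})$ is $(\tilde\Delta,\tilde{\mathbf{L}})$ with $\tilde\Delta=T(\Delta)$ and $\tilde{\mathbf{L}}=\{\tilde L_1,\dots,\tilde L_d\}$, $\tilde L_i(\tilde x)=L_i(x)/f(x)$; this is again a labelled polytope (the $\tilde L_i$ are affine linear in $\tilde x$) containing the origin. **Donaldson--Futaki invariants.** Let $dx$ be Lebesgue measure on $\mathbb{R}^m$ and let $d\sigma$ be the (positive) measure on $\partial\Delta$ defined on each facet $F_i$ by $dL_i\wedge d\sigma=-dx$. For $w\in\mathbb{R}$ and $f$ affine linear and positive on $\Delta$, the $(f,w)$-Donaldson--Futaki invariant is $$\mathcal{F}_{\Delta,\mathbf{L},f,w}(\phi)=2\int_{\partial\Delta}\frac{\phi}{f^{w-1}}\,d\sigma-\int_\Delta\frac{\phi}{f^{w+1}}\,\zeta_{(\Delta,\mathbf{L},f,w)}\,dx,$$ where $\zeta_{(\Delta,\mathbf{L},f,w)}$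 is the unique affine linear function such that $\mathcal{F}_{\Delta,\mathbf{L},f,w}(\phi)=0$ for all affine linear $\phi$. When $f\equiv1$ (so $w$ is irrelevant) one writes $\mathcal{F}_{\Delta,\mathbf{L}}$ and $\zeta_{(\Delta,\mathbf{L})}$. For $(\tilde\Delta,\tilde{\mathbf{L}})$ the measures $d\tilde x$, $d\tilde\sigma$ are defined in the same way using $\tilde x$ and $\tilde{\mathbf{L}}$. *)

(* Defs.v *)
From HB Require Import structures.
From mathcomp Require Import all_boot all_order all_algebra.
From mathcomp Require Import all_classical all_reals all_analysis.
From mathcomp Require Import measurable_realfun.

Set Implicit Arguments.
Unset Strict Implicit.
Unset Printing Implicit Defensive.

Import Order.TTheory GRing.Theory Num.Theory.
Import numFieldNormedType.Exports.

Local Open Scope classical_set_scope.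
Local Open Scope ring_scope.

Definition rV_display : measure_display.
Proof. exact: default_measure_display. Qed.

Section measurable_rV.
Context {R : realType} (n : nat).

Let coord (i : 'I_n) (x : 'rV[R]_n) : measurableTypeR R := x ord0 i.

Let rV_set0 : g_sigma_preimage coord set0.
Proof. exact: sigma_algebra0. Qed.

Let rV_setC A : g_sigma_preimage coord A -> g_sigma_preimage coord (~` A).
Proof. exact: sigma_algebraC. Qed.

Let rV_bigcup (F : _^nat) : (forall i, g_sigma_preimage coord (F i)) ->
  g_sigma_preimage coord (\bigcup_i (F i)).
Proof. exact: sigma_algebra_bigcup. Qed.

(* the Borel sigma-algebra, as the one generated by the coordinates *)
HB.instance Definition _ := @isMeasurable.Build rV_display
  'rV[R]_n (g_sigma_preimage coord) rV_set0 rV_setC rV_bigcup.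

Lemma measurable_coord (i : 'I_n) :
  measurable_fun [set: 'rV[R]_n] (fun x => x ord0 i : measurableTypeR R).
Proof.
move=> _ Y mY; rewrite setTI; apply: sub_sigma_algebra => /=.
rewrite -bigcup_seq/=; exists i => /=; first by rewrite mem_index_enum.
by exists Y => //; rewrite setTI.
Qed.

Lemma measurable_fun_rV d (T : measurableType d) (g : T -> 'rV[R]_n) :
  (forall i, measurable_fun [set: T]
    (fun t => g t ord0 i : measurableTypeR R)) ->
  measurable_fun [set: T] g.
Proof.
move=> mg _ A mA; rewrite setTI.
have : g_sigma_preimage (fun i => coord i \o g) (g @^-1` A).
  rewrite g_sigma_preimage_comp; exists A => //.
  by rewrite setTI.
apply: smallest_sub; first exact: sigma_algebra_measurable.
rewrite -bigcup_seq; apply: bigcup_sub => i _.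
by move=> B [C mC <-]; exact: mg.
Qed.

End measurable_rV.

Section lebesgue_rV.
Context {R : realType}.

Definition rV_cons n (p : measurableTypeR R * 'rV[R]_n) : 'rV[R]_n.+1 :=
  \row_i if unlift ord0 i is Some j then p.2 ord0 j else p.1.

Lemma measurable_rV_cons n : measurable_fun setT (@rV_cons n).
Proof.
apply: measurable_fun_rV => i.
case: (unliftP ord0 i) => [j ->|->].
  rewrite (_ : (fun t => _) = (fun x : 'rV[R]_n => x ord0 j) \o snd).
    exact: (measurableT_comp (measurable_coord j) measurable_snd).
  by apply/funext => t /=; rewrite mxE liftK.
rewrite (_ : (fun t => _) = fst); first exact: measurable_fst.
by apply/funext => t /=; rewrite mxE unlift_none.
Qed.

Section step.
Variables (n : nat) (mu : {sigma_finite_measure set 'rV[R]_n -> \bar R}).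

Definition lebesgue_rV_succ : set 'rV[R]_n.+1 -> \bar R :=
  pushforward (lebesgue_measure \x mu)%E (@rV_cons n).

Let succ0 : lebesgue_rV_succ set0 = 0%E.
Proof. by rewrite /lebesgue_rV_succ /pushforward preimage_set0 measure0. Qed.

Let succ_ge0 A : (0 <= lebesgue_rV_succ A)%E.
Proof. exact: (@measure_ge0 _ _ _ (lebesgue_measure \x mu)%E). Qed.

Let succ_sigma_additive : semi_sigma_additive lebesgue_rV_succ.
Proof.
pose P := measure_function_pushforward__canonical__measure_function_Measure.
exact: (@measure_semi_sigma_additive _ _ _
  (P _ _ _ _ _ (lebesgue_measure \x mu)%E _ (@measurable_rV_cons n))).
Qed.

HB.instance Definition _ := isMeasure.Build _ _ _ lebesgue_rV_succ
  succ0 succ_ge0 succ_sigma_additive.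

Let succ_sigma_finite : sigma_finite setT lebesgue_rV_succ.
Proof.
have /sigma_finiteP[F [TF ndF Foo]] := sigma_finiteT (@lebesgue_measure R).
have /sigma_finiteP[G [TG ndG Goo]] := sigma_finiteT mu.
pose hd (x : 'rV[R]_n.+1) : measurableTypeR R := x ord0 ord0.
pose tl (x : 'rV[R]_n.+1) : 'rV[R]_n := \row_j x ord0 (lift ord0 j).
have mtl : measurable_fun setT tl.
  apply: measurable_fun_rV => i.
  rewrite (_ : (fun t => _) =
    (fun t : 'rV[R]_n.+1 => t ord0 (lift ord0 i))).
    exact: measurable_coord.
  by apply/funext => t; rewrite mxE.
exists (fun k => (hd @^-1` F k) `&` (tl @^-1` G k)).
  apply/esym; rewrite -subTset => x _.
  have [i _ Fi] : (\bigcup_i F i) (hd x) by rewrite -TF.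
  have [j _ Gj] : (\bigcup_i G i) (tl x) by rewrite -TG.
  exists (maxn i j) => //; split.
  - by have /subsetPset/(_ _ Fi) := ndF _ _ (leq_maxl i j).
  - by have /subsetPset/(_ _ Gj) := ndG _ _ (leq_maxr i j).
move=> k; have [mF Fk] := Foo k; have [mG Gk] := Goo k; split.
  apply: measurableI; rewrite -[X in measurable X]setTI; last exact: mtl.
  exact: (measurable_coord ord0).
rewrite /lebesgue_rV_succ /pushforward.
rewrite (_ : _ @^-1` _ = F k `*` G k).
  by rewrite product_measure1E// lte_mul_pinfty// ge0_fin_numE.
rewrite predeqE => -[a v]; rewrite /= /hd /tl /rV_cons mxE unlift_none.
rewrite (_ : \row_j _ = v) //.
by apply/rowP => j; rewrite !mxE liftK.
Qed.

HB.instance Definition _ := Measure_isSigmaFinite.Build _ _ _ lebesgue_rV_succ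
  succ_sigma_finite.

End step.

Fixpoint lebesgue_rV n : {sigma_finite_measure set 'rV[R]_n -> \bar R} :=
  match n with
  | 0 => \d_ (0 : 'rV[R]_0)
  | k.+1 => lebesgue_rV_succ (lebesgue_rV k)
  end.

End lebesgue_rV.

(* (a, b) stands for x |-> <a, x> + b; a holds the coefficients of its
   differential *)
Definition affine (R : realType) (m : nat) : Type := ('rV[R]_m * R)%type.

HB.instance Definition _ (R : realType) m := GRing.Zmodule.on (affine R m).

Definition affine_eval (R : realType) m (L : affine R m) (x : 'rV[R]_m) : R :=
  \sum_(k < m) L.1 ord0 k * x ord0 k + L.2.

Coercion affine_eval : affine >-> Funclass.

Definition affine1 (R : realType) m : affine R m := (0, 1).

Section hyperplane_measure.
Context {R : realType} {m : nat}.
Implicit Types L : affine R m.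

(* the point of {L = 0} whose coordinates other than the j-th are given by y,
   when the j-th coefficient of dL is non-zero *)
Definition hyperplane_graph L (j : 'I_m) (y : 'rV[R]_m.-1) : 'rV[R]_m :=
  \row_k if unlift j k is Some k' then y ord0 k'
         else - (\sum_(k' < m.-1) L.1 ord0 (lift j k') * y ord0 k' + L.2)
              / L.1 ord0 j.

Lemma hyperplane_graphE L j y : L.1 ord0 j != 0 ->
  L (hyperplane_graph L j y) = 0.
Proof.
move=> aj; rewrite /affine_eval (bigD1_ord j)//= mxE unlift_none.
rewrite mulrC divfK// -addrA; apply/eqP; rewrite addrC subr_eq0; apply/eqP.
by congr (_ + _); apply: eq_bigr => k _; rewrite mxE liftK.
Qed.

Lemma measurable_hyperplane_graph L j :
  measurable_fun setT (hyperplane_graph L j).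
Proof.
apply: measurable_fun_rV => i; case: (unliftP j i) => [k ->|->].
  rewrite (_ : (fun t => _) = (fun x : 'rV[R]_m.-1 => x ord0 k)).
    exact: measurable_coord.
  by apply/funext => t; rewrite mxE liftK.
rewrite (_ : (fun t => _) = (fun y : 'rV[R]_m.-1 => - (L.1 ord0 j)^-1 *
  (\sum_(k' < m.-1) L.1 ord0 (lift j k') * y ord0 k' + L.2))); last first.
  by apply/funext => t; rewrite mxE unlift_none mulNr mulrC mulNr.
apply: measurable_funM => //; apply: measurable_funD => //.
apply: measurable_sum => k; apply: measurable_funM => //.
exact: measurable_coord.
Qed.

(* If dL has j-th coefficient a_j != 0, then the (m-1)-form on {L = 0} with
   dL /\ d(sigma) = - dx is (up to sign) the restriction of
   a_j^-1 * dx_1 ... dx_{j-1} dx_{j+1} ... dx_m. It does not depend on j. *)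
Definition hyperplane_measure L (A : set 'rV[R]_m) : \bar R :=
  if [pick j | L.1 ord0 j != 0] is Some j
  then (`|L.1 ord0 j|^-1%:E *
        lebesgue_rV m.-1 (hyperplane_graph L j @^-1` A))%E
  else 0%E.

Section measure.
Variable L : affine R m.

Let hm0 : hyperplane_measure L set0 = 0%E.
Proof.
rewrite /hyperplane_measure; case: pickP => // j _.
by rewrite preimage_set0 measure0 mule0.
Qed.

Let hm_ge0 A : (0 <= hyperplane_measure L A)%E.
Proof.
rewrite /hyperplane_measure; case: pickP => // j _.
by rewrite mule_ge0// lee_fin invr_ge0.
Qed.

Let hm_sigma_additive : semi_sigma_additive (hyperplane_measure L).
Proof.
rewrite /hyperplane_measure; case: pickP => [j _|_]; last first.
  exact: (@measure_semi_sigma_additive _ _ _ mzero).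
pose P := measure_function_pushforward__canonical__measure_function_Measure.
pose c : {nonneg R} := NngNum (ltac:(by rewrite invr_ge0) :
  0 <= `|L.1 ord0 j|^-1).
exact: (@measure_semi_sigma_additive _ _ _ (mscale c
  (P _ _ _ _ _ (lebesgue_rV m.-1) _ (measurable_hyperplane_graph L j)))).
Qed.

HB.instance Definition _ := isMeasure.Build _ _ _ (hyperplane_measure L)
  hm0 hm_ge0 hm_sigma_additive.

End measure.
End hyperplane_measure.

Section polytope.
Context {R : realType} {m : nat}.
Implicit Types (Delta F : set 'rV[R]_m) (v : 'rV[R]_m).

Definition affinely_independent n (p : 'I_n -> 'rV[R]_m) : bool :=
  row_free (\matrix_(i < n) row_mx (1%:M : 'rV[R]_1) (p i)).

Definition is_face Delta F := exists2 l : affine R m,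
  forall x, Delta x -> 0 <= l x & F = Delta `&` [set x | l x = 0].

(* the affine hull of F has dimension n - 1 *)
Definition affine_rank F n :=
  (exists2 p : 'I_n -> 'rV[R]_m, forall i, F (p i) & affinely_independent p)
  /\ ~ (exists2 p : 'I_n.+1 -> 'rV[R]_m,
          forall i, F (p i) & affinely_independent p).

Definition is_facet Delta F := is_face Delta F /\ affine_rank F m.

Definition is_vertex Delta v := is_face Delta [set v].

Definition label_facet d Delta (L : 'I_d -> affine R m) (i : 'I_d) :=
  Delta `&` [set x | L i x = 0].

Record labelled_polytope d Delta (L : 'I_d -> affine R m) : Prop := {
  lp_compact : compact Delta ;
  lp_convex : convex_set Delta ;
  lp_interior : Delta° !=set0 ;
  lp_halfspaces : Delta = [set x | forall i, 0 <= L i x] ;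
  lp_facet : forall i, is_facet Delta (label_facet Delta L i) ;
  lp_facet_inj : injective (label_facet Delta L) ;
  lp_facet_surj : forall F, is_facet Delta F ->
    exists i, F = label_facet Delta L i ;
  lp_simple : forall v, is_vertex Delta v ->
    #|[set i | v \in label_facet Delta L i]%SET| = m }.

End polytope.

Section Donaldson_Futaki.
Context {R : realType} {m d : nat}.
Variables (Delta : set 'rV[R]_m) (L : 'I_d -> affine R m).

Definition boundary_integral (g : 'rV[R]_m -> R) : R :=
  \sum_(i < d)
    \int[hyperplane_measure (L i)]_(x in label_facet Delta L i) g x.

Definition DF_functional (f : affine R m) (w : R) (z : affine R m)
    (phi : 'rV[R]_m -> R) : R :=
  2 * boundary_integral (fun x => phi x / f x `^ (w - 1))
  - \int[lebesgue_rV m]_(x in Delta) (phi x / f x `^ (w + 1) * z x).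

(* the affine function z for which the functional vanishes on all affine
   functions; 0 is a default value that is not used on labelled polytopes *)
Definition DF_zeta (f : affine R m) (w : R) : affine R m :=
  xget 0 [set z | forall phi : affine R m, DF_functional f w z phi = 0].

Definition DF_invariant (f : affine R m) (w : R) (phi : 'rV[R]_m -> R) : R :=
  DF_functional f w (DF_zeta f w) phi.

(* the case f = 1, in which the weight is irrelevant since 1 `^ r = 1 *)
Definition DF_zeta1 : affine R m := DF_zeta (affine1 R m) 0.

Definition DF_invariant1 (phi : 'rV[R]_m -> R) : R :=
  DF_invariant (affine1 R m) 0 phi.

End Donaldson_Futaki.

Section twist.
Context {R : realType} {m : nat}.
Implicit Types f : affine R m.

Definition twist_map f (x : 'rV[R]_m) : 'rV[R]_m := (f x)^-1 *: x.

Definition is_twist f d (Delta : set 'rV[R]_m) (L : 'I_d -> affine R m)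
    (Delta' : set 'rV[R]_m) (L' : 'I_d -> affine R m) :=
  Delta' = twist_map f @` Delta /\
  forall i x, Delta x -> L' i (twist_map f x) = L i x / f x.

Lemma is_twist_ex f d (Delta : set 'rV[R]_m) (L : 'I_d -> affine R m) :
  Delta 0 -> (forall x, Delta x -> 0 < f x) ->
  exists Delta' L', is_twist f Delta L Delta' L'.
Proof.
move=> D0 fpos; exists (twist_map f @` Delta).
exists (fun i => ((L i).1 - ((L i).2 / f.2) *: f.1, (L i).2 / f.2)).
split=> // i x /fpos /lt0r_neq0; have := fpos _ D0.
rewrite /affine_eval big1 ?add0r => [/lt0r_neq0 f20|k _];
  last by rewrite mxE mulr0.
set s := \sum_(k < m) _; set t := \sum_(k < m) (L i).1 ord0 k * _ => fx0.
rewrite (_ : \sum_(k < m) _ = (t - (L i).2 / f.2 * s) / (s + f.2)).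
  apply: (mulIf fx0); rewrite mulrDl !divfK// mulrDr divfK//.
  by rewrite addrA subrK.
rewrite mulr_sumr -sumrB mulr_suml; apply: eq_bigr => k _.
rewrite /twist_map !mxE mulrCA [RHS]mulrC; congr (_ * _).
by rewrite mulrBl mulrA.
Qed.

End twist.

(* Main.v *)
Require Import Defs.
From mathcomp Require Import all_boot all_order all_algebra.
From mathcomp Require Import all_classical all_reals all_analysis.
From mathcomp Require Import measurable_realfun ring lra.
Import Order.TTheory GRing.Theory Num.Theory.
Import numFieldNormedType.Exports.
Local Open Scope classical_set_scope.
Local Open Scope ring_scope.

Set Implicit Arguments.
Unset Strict Implicit.
Unset Printing Implicit Defensive.

(** The twist [x |-> x / f x] is the projectivisation of the linear shear
    [(t, y) |-> (f.2 * t + <f.1, y>, y)], so it identifies two affine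
    hyperplanes [<p, y> = 1] and [<p', y> = 1] that cut the same cone. Writing
    Lebesgue measure in polar coordinates [y = s *: x] over either hyperplane
    gives the Jacobian: [dx'] is [f.2 * f^-(m+1) * dx], and [dsigma'] is
    [f.2 * f^-m * dsigma] on each facet. A facet whose hyperplane avoids the
    origin is itself such a section of a cone in [R^m]; on a facet through the
    origin, where both labels have the same differential, the twist is again a
    twist of a coordinate space of dimension [m - 1]. Substituting matches the
    two Donaldson-Futaki functionals term by term, for [z] and [z'] related by
    [z' (x / f x) = z x / f x]. Since the extremal affine function is unique
    (the difference [z] of two of them satisfies [\int z^2 / f^(m+3) = 0]), the
    correspondence [z |-> z'] respects it. *)

(** Real powers [powR] are measurable, but with exponent -1 they give the inverse only on
    nonnegative bases; the square supplies such a base. *)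
Lemma measurable_invr (R : realType) :
  measurable_fun [set: R] (fun x : R => x^-1).
Proof.
rewrite (_ : (fun x => _) = (fun x : R => x * (x ^+ 2) `^ (-1))).
  apply: measurable_funM => //.
  apply: (measurableT_comp (measurable_powR (-1))); exact: measurable_funX.
apply/funext => x; have [->|x0] := eqVneq x 0; first by rewrite invr0 mul0r.
by rewrite powR_inv1 ?sqr_ge0//; field.
Qed.

(** * Affine substitutions and coordinate splitting for Lebesgue measure *)

Section change_of_variables.
Context {R : realType}.
Implicit Types (n : nat) (c b : R).

Local Notation mR := (measurableTypeR R).
Local Notation pushforward_measure :=
  measure_function_pushforward__canonical__measure_function_Measure.

Lemma measurable_affine c b :
  measurable_fun setT (fun t => c * t + b : mR).
Proof. by apply: measurable_funD => //; exact: measurable_funM. Qed.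

(** The right-hand side is a measure in [A], so by uniqueness of Lebesgue measure it is enough to
    compare values on half-open intervals. *)
Lemma lebesgue_measure_affine c b (A : set R) : c != 0 -> measurable A ->
  lebesgue_measure A =
  (`|c|%:E * lebesgue_measure ((fun t => c * t + b)%R @^-1` A))%E.
Proof.
move=> c0 mA.
pose k : {nonneg R} := NngNum (normr_ge0 c).
pose nu := mscale k (pushforward_measure (@lebesgue_measure R)
  (measurable_affine c b)).
apply: (@lebesgue_measure_unique R nu) => //= _ [[x y] _ <-] /=.
rewrite /nu /= /mscale /= /pushforward.
pose x' := (x - b) / c; pose y' := (y - b) / c.
have xE : x = c * x' + b by rewrite /x'; field.
have yE : y = c * y' + b by rewrite /y'; field.
have [cgt|clt|cE] := ltrgtP c 0; last by rewrite cE eqxx in c0.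
  (* A negative slope reverses the order, so the preimage of []x, y]] is closed on the left and open
     on the right. *)
  rewrite (_ : _ @^-1` _ = `[y', x'[%classic).
    rewrite !lebesgue_measure_itv /= !lte_fin xE yE ltrD2r ltr_nM2l//.
    case: ifP => _; last by rewrite mule0.
    by rewrite -!EFinB -EFinM; congr (_%:E); rewrite ltr0_norm//; ring.
  apply/seteqP; split => t /=; rewrite !in_itv /= xE yE lerD2r ltrD2r;
    by rewrite ltr_nM2l// ler_nM2l// andbC.
rewrite (_ : _ @^-1` _ = `]x', y']%classic).
  rewrite !lebesgue_measure_itv /= !lte_fin xE yE ltrD2r ltr_pM2l//.
  case: ifP => _; last by rewrite mule0.
  by rewrite -!EFinB -EFinM; congr (_%:E); rewrite gtr0_norm//; ring.
apply/seteqP; split => t /=; rewrite !in_itv /= xE yE lerD2r ltrD2r;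
  by rewrite ltr_pM2l// ler_pM2l.
Qed.

Lemma integral_lebesgue_affine c b (G : R -> \bar R) : c != 0 ->
  measurable_fun setT G -> (forall x, 0 <= G x)%E ->
  (\int[lebesgue_measure]_t G t =
   `|c|%:E * \int[lebesgue_measure]_t G (c * t + b)%R)%E.
Proof.
move=> c0 mG G0.
pose k : {nonneg R} := NngNum (normr_ge0 c).
pose nu := pushforward_measure (@lebesgue_measure R) (measurable_affine c b).
transitivity (\int[mscale k nu]_t G t)%E.
  by apply: eq_measure_integral => A mA _; exact: lebesgue_measure_affine.
rewrite ge0_integral_mscale//; congr (_ * _)%E.
have := @ge0_integral_pushforward _ _ (mR) (mR) R
  _ (measurable_affine c b) lebesgue_measure _ _ measurableT mG
  (fun x _ => G0 x).
by rewrite preimage_setT => <-; apply: eq_measure_integral => //;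
  exact: measurable_affine.
Qed.

Lemma integral_rV_succ n (G : 'rV[R]_n.+1 -> \bar R) :
  measurable_fun setT G -> (forall x, 0 <= G x)%E ->
  (\int[lebesgue_rV n.+1]_x G x =
   \int[lebesgue_measure]_t \int[lebesgue_rV n]_y G (rV_cons (t, y)))%E.
Proof.
move=> mG G0.
have := ge0_integral_pushforward (@measurable_rV_cons R n)
  (lebesgue_measure \x lebesgue_rV n)%E measurableT mG (fun x _ => G0 x).
rewrite preimage_setT fubini_tonelli1//=.
by apply: measurableT_comp => //; exact: measurable_rV_cons.
Qed.

Lemma measurable_fun_rV_cons n d (T : measurableType d)
    (u : T -> R) (v : T -> 'rV[R]_n) :
  measurable_fun setT u -> measurable_fun setT v ->
  measurable_fun setT (fun t => rV_cons (u t : mR, v t)).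
Proof.
move=> mu mv; apply: (measurableT_comp (@measurable_rV_cons R n)).
exact: measurable_fun_pair.
Qed.

Lemma measurable_fun_coord n d (T : measurableType d) (v : T -> 'rV[R]_n) i :
  measurable_fun setT v -> measurable_fun setT (fun t => v t ord0 i).
Proof. exact: (measurableT_comp (measurable_coord i)). Qed.

Lemma measurable_fun_scale n d (T : measurableType d)
    (u : T -> R) (v : T -> 'rV[R]_n) :
  measurable_fun setT u -> measurable_fun setT v ->
  measurable_fun setT (fun t => u t *: v t).
Proof.
move=> mu mv; apply: measurable_fun_rV => i.
rewrite (_ : (fun t => _) = (fun t => u t * v t ord0 i)).
  by apply: measurable_funM => //; exact: measurable_fun_coord.
by apply/funext => t; rewrite mxE.
Qed.

Lemma measurable_fun_dot n d (T : measurableType d) (p : 'I_n -> R)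
    (v : T -> 'rV[R]_n) :
  measurable_fun setT v ->
  measurable_fun setT (fun t => \sum_k p k * v t ord0 k).
Proof.
move=> mv; apply: measurable_sum => k; apply: measurable_funM => //.
exact: measurable_fun_coord.
Qed.

Lemma scale_rV_cons n c (t : R) (y : 'rV[R]_n) :
  c *: rV_cons (t : mR, y) =
  rV_cons (c * t : mR, c *: y).
Proof.
apply/rowP => i; rewrite !mxE; case: (unliftP ord0 i) => [j _|_] //=.
by rewrite mxE.
Qed.

(** Induction on [n]: the inner integral contributes [|c| ^+ n], the split-off coordinate one
    further factor [|c|]. *)
Lemma integral_rV_scale n c (G : 'rV[R]_n -> \bar R) : c != 0 ->
  measurable_fun setT G -> (forall x, 0 <= G x)%E ->
  (\int[lebesgue_rV n]_x G x =
   (`|c| ^+ n)%:E * \int[lebesgue_rV n]_x G (c *: x)%R)%E.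
Proof.
move=> c0; elim: n => [|n IHn] in G *  => mG G0.
  rewrite expr0 mul1e; apply: eq_integral => x _; congr G.
  by apply/rowP => -[].
have mGc : measurable_fun setT (fun x : 'rV[R]_n.+1 => G (c *: x)).
  by apply: (measurableT_comp mG); exact: measurable_fun_scale.
have mGcons u (v : 'rV[R]_n -> 'rV[R]_n) : measurable_fun setT v ->
    measurable_fun setT (fun y => G (rV_cons (u : mR, v y))).
  by move=> mv; apply: (measurableT_comp mG); exact: measurable_fun_rV_cons.
pose F t := (\int[lebesgue_rV n]_y G (rV_cons (t : mR, c *: y)%R))%E.
have F0 t : (0 <= F t)%E by exact: integral_ge0.
have mF : measurable_fun setT F.
  apply: (measurable_fun_fubini_tonelli_F
    (fun ty : R * 'rV[R]_n => G (rV_cons (ty.1 : mR, c *: ty.2)))).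
    apply: (measurableT_comp mG); apply: measurable_fun_rV_cons => //.
    exact: measurable_fun_scale.
  by [].
rewrite !integral_rV_succ//.
transitivity (\int[lebesgue_measure]_t ((`|c| ^+ n)%:E * F t))%E.
  apply: eq_integral => t _; rewrite (IHn (fun y => G (rV_cons (t, y))))//.
  exact: mGcons.
rewrite ge0_integralZl//.
rewrite [X in (_ * X)%E = _](integral_lebesgue_affine 0 c0 mF F0).
rewrite muleA -EFinM -exprSr.
congr (_ * _)%E; apply: eq_integral => t _; apply: eq_integral => y _.
by rewrite addr0 -scale_rV_cons.
Qed.

(** The counterpart of [rV_cons] at an arbitrary position; values of [hyperplane_graph] have this
    form, with [t] solved from the equation. *)
Definition insert_coord n (j : 'I_n.+1) (t : R) (y : 'rV[R]_n) : 'rV[R]_n.+1 :=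
  \row_k if unlift j k is Some k' then y ord0 k' else t.

Lemma measurable_fun_insert n j d (T : measurableType d)
    (u : T -> R) (v : T -> 'rV[R]_n) :
  measurable_fun setT u -> measurable_fun setT v ->
  measurable_fun setT (fun t => insert_coord j (u t) (v t)).
Proof.
move=> mu mv; apply: measurable_fun_rV => i.
case: (unliftP j i) => [k ->|->].
  rewrite (_ : (fun t => _) = (fun t => v t ord0 k)).
    exact: measurable_fun_coord.
  by apply/funext => t; rewrite mxE liftK.
rewrite (_ : (fun t => _) = u) //.
by apply/funext => t; rewrite mxE unlift_none.
Qed.

Lemma insert_coord_cons n (j : 'I_n.+1) (s t : R) (y : 'rV[R]_n) :
  insert_coord (lift ord0 j) t (rV_cons (s : mR, y)) =
  rV_cons (s : mR, insert_coord j t y).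
Proof.
apply/rowP => i; rewrite mxE [RHS]mxE.
case: (unliftP ord0 i) => [k ->|->] /=.
  rewrite mxE; case: (unliftP j k) => [k' ->|->].
    rewrite (_ : lift ord0 (lift j k') = lift (lift ord0 j) (lift ord0 k')).
      by rewrite liftK mxE liftK.
    by apply: val_inj; rewrite /= /bump /= !add1n ltnS addnS.
  by rewrite unlift_none.
rewrite (_ : ord0 = lift (lift ord0 j) ord0); last exact: val_inj.
by rewrite liftK mxE unlift_none.
Qed.

(** By construction [lebesgue_rV] splits off the first coordinate; induction and Tonelli's theorem
    bring any other coordinate outside. *)
Lemma integral_rV_insert n (j : 'I_n.+1) (G : 'rV[R]_n.+1 -> \bar R) :
  measurable_fun setT G -> (forall x, 0 <= G x)%E ->
  (\int[lebesgue_rV n.+1]_x G x =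
   \int[lebesgue_measure]_t \int[lebesgue_rV n]_y G (insert_coord j t y))%E.
Proof.
elim: n => [|n IHn] in j G * => mG G0; first by rewrite ord1 integral_rV_succ.
case: (unliftP ord0 j) => [k ->|->]; last by rewrite integral_rV_succ.
rewrite integral_rV_succ//.
pose H (s t : R) := (\int[lebesgue_rV n]_y
  G (rV_cons (s : mR, insert_coord k t y)))%E.
have mGcons u d (T : measurableType d) (v : T -> 'rV[R]_n.+1) :
    measurable_fun setT v ->
    measurable_fun setT (fun y => G (rV_cons (u : mR, v y))).
  by move=> mv; apply: (measurableT_comp mG); exact: measurable_fun_rV_cons.
transitivity (\int[lebesgue_measure]_s \int[lebesgue_measure]_t H s t)%E.
  apply: eq_integral => s _; rewrite (IHn k (fun y => G (rV_cons (s, y))))//.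
  exact: mGcons.
have mH : measurable_fun setT (fun st : mR * mR =>
    H st.1 st.2).
  apply: (measurable_fun_fubini_tonelli_F
    (fun z : (mR * mR) * 'rV[R]_n =>
      G (rV_cons (z.1.1 : mR, insert_coord k z.1.2 z.2)))) => //.
  apply: (measurableT_comp mG); apply: measurable_fun_rV_cons => //.
    exact: (measurableT_comp measurable_fst measurable_fst).
  apply: measurable_fun_insert => //.
  exact: (measurableT_comp measurable_snd measurable_fst).
(* The coordinate [t] at position [j] moves outside the first coordinate [s]. *)
transitivity (\int[lebesgue_measure]_t \int[lebesgue_measure]_s H s t)%E.
  apply: (fubini_tonelli (fun st : mR * mR =>
    H st.1 st.2)) => //= st.
  exact: integral_ge0.
apply: eq_integral => t _; rewrite integral_rV_succ//.
  apply: eq_integral => s _; apply: eq_integral => y _.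
  by rewrite insert_coord_cons.
by apply: (measurableT_comp mG); exact: measurable_fun_insert.
Qed.

End change_of_variables.

(** * Polar coordinates over an affine hyperplane *)

Section cone.
Context {R : realType}.

Definition dotr n (p y : 'rV[R]_n) : R := \sum_k p ord0 k * y ord0 k.

Lemma dotrZr n (p y : 'rV[R]_n) c : dotr p (c *: y) = c * dotr p y.
Proof.
by rewrite /dotr mulr_sumr; apply: eq_bigr => k _; rewrite mxE mulrCA.
Qed.

Lemma dotr_insert n (p : 'rV[R]_n.+1) j t (y : 'rV[R]_n) :
  dotr p (insert_coord j t y) =
  p ord0 j * t + \sum_k p ord0 (lift j k) * y ord0 k.
Proof.
rewrite /dotr (bigD1_ord j)//= mxE unlift_none; congr (_ + _).
by apply: eq_bigr => k _; rewrite mxE liftK.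
Qed.

Lemma measurable_fun_dotr n (p : 'rV[R]_n) d (T : measurableType d)
    (v : T -> 'rV[R]_n) :
  measurable_fun setT v -> measurable_fun setT (fun t => dotr p (v t)).
Proof. exact: measurable_fun_dot. Qed.

Definition chart n (p : 'rV[R]_n.+1) (j : 'I_n.+1) (x : 'rV[R]_n) :
  'rV[R]_n.+1 := hyperplane_graph ((p, -1) : affine R n.+1) j x.

Lemma dotr_chart n (p : 'rV[R]_n.+1) j x : p ord0 j != 0 ->
  dotr p (chart p j x) = 1.
Proof.
move=> pj; apply/eqP; rewrite -subr_eq0; apply/eqP.
exact: (@hyperplane_graphE R n.+1 (p, -1)).
Qed.

(** Separates the two substitutions behind polar coordinates: at fixed [y = s *: x] the inserted
    coordinate is affine in [s], and at fixed [s] the vector [y] is a dilate of [x]. *)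
Lemma scale_chart n (p : 'rV[R]_n.+1) j s x : p ord0 j != 0 ->
  s *: chart p j x = insert_coord j ((p ord0 j)^-1 * s +
    - (p ord0 j)^-1 * \sum_k p ord0 (lift j k) * (s *: x) ord0 k) (s *: x).
Proof.
move=> pj; apply/rowP => k; rewrite !mxE.
case: (unliftP j k) => [k' _|_] /=; first by rewrite mxE.
rewrite [in RHS](_ : \sum_k0 _ * _ =
    s * \sum_k' p ord0 (lift j k') * x ord0 k').
  by field.
by rewrite mulr_sumr; apply: eq_bigr => i _; rewrite mxE mulrCA.
Qed.

Lemma measurable_fun_chart n (p : 'rV[R]_n.+1) j d (T : measurableType d)
    (v : T -> 'rV[R]_n) :
  measurable_fun setT v -> measurable_fun setT (fun t => chart p j (v t)).
Proof.
exact: (measurableT_comp (@measurable_hyperplane_graph R n.+1 (p, -1) j)).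
Qed.

Local Notation mR := (measurableTypeR R).

Lemma exchange_lebesgue_rV n (H : R -> 'rV[R]_n -> \bar R) :
  measurable_fun setT (fun z : mR * 'rV[R]_n => H z.1 z.2) ->
  (forall t y, 0 <= H t y)%E ->
  (\int[lebesgue_measure]_t \int[lebesgue_rV n]_y H t y =
   \int[lebesgue_rV n]_y \int[lebesgue_measure]_t H t y)%E.
Proof.
by move=> mH H0; apply: (fubini_tonelli (fun z : mR * 'rV[R]_n => H z.1 z.2)).
Qed.

(* Polar coordinates [y = s *: x] with [x] in the hyperplane [dotr p x = 1]. *)
Lemma integral_cone n (p : 'rV[R]_n.+1) j (G : 'rV[R]_n.+1 -> \bar R) :
  p ord0 j != 0 -> measurable_fun setT G -> (forall y, 0 <= G y)%E ->
  (forall y, dotr p y <= 0 -> G y = 0%E) ->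
  (\int[lebesgue_rV n.+1]_y G y = `|p ord0 j|^-1%:E *
   \int[lebesgue_rV n]_x \int[lebesgue_measure]_s
     ((`|s| ^+ n)%:E * G (s *: chart p j x)%R))%E.
Proof.
move=> pj mG G0 Gp.
(* With [t = c * s + b y], the point [insert_coord j t y] lies on the hyperplane [dotr p = s]. *)
set c := (p ord0 j)^-1; have c0 : c != 0 by rewrite invr_eq0.
pose b (y : 'rV[R]_n) := - c * \sum_k p ord0 (lift j k) * y ord0 k.
have mb d (T : measurableType d) (v : T -> 'rV[R]_n) : measurable_fun setT v ->
    measurable_fun setT (fun t => b (v t)).
  by move=> mv; apply: measurable_funM => //; exact: measurable_fun_dot.
pose H s y := G (insert_coord j (c * s + b y) y).
have mH : measurable_fun setT (fun z : mR * 'rV[R]_n => H z.1 z.2).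
  apply: (measurableT_comp mG); apply: measurable_fun_insert => //.
  by apply: measurable_funD; [exact: measurable_funM|exact: mb].
have mHs s : measurable_fun setT (H s).
  apply: (measurableT_comp mG); apply: measurable_fun_insert => //.
  by apply: measurable_funD => //; exact: mb.
have H0 s y : (0 <= H s y)%E by exact: G0.
have Hc s x : H s (s *: x) = G (s *: chart p j x) by rewrite scale_chart.
rewrite (integral_rV_insert j)// exchange_lebesgue_rV//; last first.
  by apply: (measurableT_comp mG); exact: measurable_fun_insert.
transitivity (\int[lebesgue_rV n]_y
    (`|c|%:E * \int[lebesgue_measure]_s H s y))%E.
  apply: eq_integral => y _; apply: integral_lebesgue_affine => //.
  by apply: (measurableT_comp mG); exact: measurable_fun_insert.
rewrite ge0_integralZl//; last 2 first.
- by apply: (@measurable_fun_fubini_tonelli_G _ _ _ _ R lebesgue_measure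
    (fun z : mR * 'rV[R]_n => H z.1 z.2)).
- by move=> y _; exact: integral_ge0.
rewrite normfV; congr (_ * _)%E.
have mK : measurable_fun setT (fun z : mR * 'rV[R]_n =>
    ((`|z.1| ^+ n)%:E * G (z.1 *: chart p j z.2))%E).
  apply: emeasurable_funM.
    apply/measurable_EFinP; apply: measurable_funX.
    by apply: measurableT_comp => //; exact: measurable_fst.
  apply: (measurableT_comp mG); apply: measurable_fun_scale => //.
  exact: measurable_fun_chart.
rewrite -!exchange_lebesgue_rV//; last first.
  by move=> t y; rewrite mule_ge0// lee_fin exprn_ge0.
apply: eq_integral => s _.
(* For [s <= 0] both integrands vanish, since [G] is zero where [dotr p <= 0]. *)
have [s0|s0] := leP s 0.
  rewrite [LHS]integral0_eq ?[RHS]integral0_eq// => y _.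
    by rewrite Gp ?mule0// dotrZr dotr_chart// mulr1.
  rewrite /H Gp// dotr_insert mulrDr mulrA mulfV// mul1r /b mulrA mulrN mulfV//.
  by rewrite mulN1r addrNK.
(* For [s > 0] the dilation [y = s *: x] in dimension [n] produces the density [s ^+ n]. *)
rewrite (integral_rV_scale (lt0r_neq0 s0))// ge0_integralZl//; last first.
  by apply: (measurableT_comp mG); apply: measurable_fun_scale => //;
    exact: measurable_fun_chart.
by congr (_ * _)%E; apply: eq_integral => x _; rewrite Hc.
Qed.

(** On a ray along which a linear form has slope [q], the slab between the levels 1 and 2 is
    [[q^-1, 2 / q]], of length [q^-1]. *)
Lemma integral_lebesgue_window (q : R) (k : \bar R) : 0 < q -> (0 <= k)%E ->
  (\int[lebesgue_measure]_s (if (1 <= s * q <= 2)%R then k else 0) =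
   q^-1%:E * k)%E.
Proof.
move=> q0 k0.
rewrite (eq_integral (fun s : mR =>
    k * (\1_(`[q^-1, 2 / q]%classic : set R) s)%:E)%E); last first.
  move=> s _; rewrite indicE mem_setE in_itv/= ler_pdivlMr//.
  rewrite -ler_pdivrMr// div1r.
  by case: ifP; rewrite ?mule1 ?mule0.
rewrite ge0_integralZl//; last first.
  by apply/measurable_EFinP; exact: measurable_indic.
rewrite integral_indic// setIT [X in (_ * X)%E]lebesgue_measure_itv/= lte_fin.
rewrite ltr_pMl ?invr_gt0// ltr1n -EFinB muleC; congr (_%:E * _)%E.
by field; rewrite gt_eqF.
Qed.

(* Both sides compute the integral over the cone, in polar coordinates, of
   [K y / (dotr p' y) ^+ n] restricted to the slab [1 <= dotr p' y <= 2]. *)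
Lemma integral_chart_change n (p p' : 'rV[R]_n.+1) j j'
    (K : 'rV[R]_n.+1 -> \bar R) :
  p ord0 j != 0 -> p' ord0 j' != 0 ->
  measurable_fun setT K -> (forall y, 0 <= K y)%E ->
  (forall y, dotr p y <= 0 -> K y = 0%E) ->
  (forall y, dotr p' y <= 0 -> K y = 0%E) ->
  (forall c y, 0 < c -> K (c *: y) = K y) ->
  (`|p' ord0 j'|^-1%:E * \int[lebesgue_rV n]_x K (chart p' j' x) =
   `|p ord0 j|^-1%:E * \int[lebesgue_rV n]_x
     (((dotr p' (chart p j x))^-1 ^+ n.+1)%:E * K (chart p j x)))%E.
Proof.
move=> pj pj' mK K0 Kp Kp' Kc.
(* The factor [(dotr p' y)^-1 ^+ n] cancels the polar density [s ^+ n], so the integrand is constant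
   along each ray inside the slab. *)
pose G y := if 1 <= dotr p' y <= 2 then
  (((dotr p' y)^-1 ^+ n)%:E * K y)%E else 0%E.
have mp' : measurable_fun setT (fun y : 'rV[R]_n.+1 => dotr p' y).
  exact: measurable_fun_dotr.
have mG : measurable_fun setT G.
  apply: measurable_fun_ifT => //.
    by apply: measurable_and; exact: measurable_fun_ler.
  apply: emeasurable_funM => //; apply/measurable_EFinP/measurable_funX.
  by apply: measurableT_comp => //; exact: measurable_invr.
have G0 y : (0 <= G y)%E.
  rewrite /G; case: ifP => // /andP[p1 _]; rewrite mule_ge0// lee_fin.
  by rewrite exprn_ge0// invr_ge0 (le_trans ler01).
have Gp y : dotr p y <= 0 -> G y = 0%E.
  by move=> /Kp Ky; rewrite /G Ky mule0; case: ifP.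
have Gp' y : dotr p' y <= 0 -> G y = 0%E.
  by move=> /Kp' Ky; rewrite /G Ky mule0; case: ifP.
have GE (s : R) x q : dotr p' x = q ->  (0 < s)%R -> (0 < q)%R ->
  ((`|s| ^+ n)%:E * G (s *: x)%R =
   if (1 <= s * q <= 2)%R then (q^-1 ^+ n)%:E * K x else 0)%E.
  move=> <- s0 q0; rewrite /G dotrZr; case: ifP => _; last by rewrite mule0.
  rewrite Kc// muleA -EFinM gtr0_norm//; congr (_%:E * _)%E.
  rewrite -exprMn; congr (_ ^+ _); field.
  by rewrite !gt_eqF.
(* Over the chart of [p'] every ray has slope 1, so the window has length 1. *)
transitivity (\int[lebesgue_rV n.+1]_y G y)%E.
  rewrite (integral_cone pj')//; congr (_ * _)%E.
  apply: eq_integral => x _.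
  transitivity (\int[lebesgue_measure]_s
      (if (1 <= s * 1 <= 2)%R then K (chart p' j' x) else 0))%E.
    by rewrite integral_lebesgue_window// invr1 mul1e.
  apply: eq_integral => s _; have [s0|s0] := leP s 0.
    rewrite Gp' ?mule0; last by rewrite dotrZr dotr_chart// mulr1.
    by rewrite mulr1 leNgt (le_lt_trans s0).
  by rewrite (GE _ _ 1)// ?dotr_chart// invr1 expr1n mul1e.
(* Over the chart of [p] the window has length [q^-1], which raises the exponent from [n] to [n.+1];
   rays with [q <= 0] contribute zero. *)
rewrite (integral_cone pj)//; congr (_ * _)%E.
apply: eq_integral => x _; set q := dotr p' _.
have [q0|q0] := leP q 0.
  rewrite Kp'// mule0 integral0_eq// => s _.
  have [s0|s0] := leP s 0.
    by rewrite Gp ?mule0// dotrZr dotr_chart// mulr1.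
  by rewrite Gp' ?mule0// dotrZr pmulr_rle0.
rewrite exprS EFinM -muleA -integral_lebesgue_window//; last first.
  by rewrite mule_ge0// lee_fin exprn_ge0// invr_ge0 ltW.
apply: eq_integral => s _; have [s0|s0] := leP s 0; last exact: GE.
rewrite Gp ?mule0; last by rewrite dotrZr dotr_chart// mulr1.
by rewrite leNgt (le_lt_trans _ ltr01)// pmulr_lle0.
Qed.

End cone.

(** * The twist as a chart change for volume integrals *)

Section twist_integral.
Context {R : realType}.
Local Notation mR := (measurableTypeR R).

Lemma affine_evalE n (f : affine R n) x : f x = dotr f.1 x + f.2.
Proof. by []. Qed.

Lemma measurable_fun_affine n (f : affine R n) d (T : measurableType d)
    (v : T -> 'rV[R]_n) :
  measurable_fun setT v -> measurable_fun setT (fun t => f (v t)).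
Proof.
by move=> mv; apply: measurable_funD => //; exact: measurable_fun_dotr.
Qed.

(* For [x' = twist_map f x] this is [(f x)^-1], so that [x] is recovered as
   [(untwist_factor f x')^-1 *: x']. *)
Definition untwist_factor n (f : affine R n) (x' : 'rV[R]_n) : R :=
  (1 - dotr f.1 x') / f.2.

Lemma untwist_factor_twist n (f : affine R n) x : f.2 != 0 -> f x != 0 ->
  untwist_factor f (twist_map f x) = (f x)^-1.
Proof.
move=> f2; rewrite /untwist_factor /twist_map dotrZr affine_evalE => fx.
by field; rewrite f2 fx.
Qed.

Lemma affine_untwist n (f : affine R n) x' : f.2 != 0 ->
  untwist_factor f x' != 0 ->
  f ((untwist_factor f x')^-1 *: x') = (untwist_factor f x')^-1.
Proof.
move=> f2; rewrite affine_evalE dotrZr /untwist_factor => t0.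
have a0 : 1 - dotr f.1 x' != 0.
  by apply: contra_neq t0 => ->; rewrite mul0r.
by field; rewrite a0 f2.
Qed.

(** For [f.2 != 0] the half-space [untwist_factor f x' > 0] contains the twisted image of every set
    on which [f > 0], so the extension by zero is compatible with restriction to such images. *)
Definition untwist n (f : affine R n) (k : 'rV[R]_n -> \bar R) x' : \bar R :=
  if 0 < untwist_factor f x' then k ((untwist_factor f x')^-1 *: x') else 0%E.

Lemma measurable_untwist n (f : affine R n) k :
  measurable_fun setT k -> measurable_fun setT (untwist f k).
Proof.
move=> mk.
have mt : measurable_fun setT (untwist_factor f : 'rV[R]_n -> R).
  apply: measurable_funM => //; apply: measurable_funB => //.
  exact: measurable_fun_dotr.
apply: measurable_fun_ifT => //; first exact: measurable_fun_ltr.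
apply: (measurableT_comp mk); apply: measurable_fun_scale => //.
by apply: measurableT_comp => //; exact: measurable_invr.
Qed.

Lemma measurable_weight n (f : affine R n) N (A : set 'rV[R]_n)
    (u : 'rV[R]_n -> \bar R) : measurable A -> measurable_fun A u ->
  measurable_fun setT ((fun x => (f x ^+ N)%:E * u x)%E \_ A).
Proof.
move=> mA mu; apply/(measurable_restrictT _ mA); apply: emeasurable_funM => //.
apply/measurable_EFinP; apply: measurable_funTS; apply: measurable_funX.
exact: measurable_fun_affine.
Qed.

(** Expresses [u'] on the image through [u] alone, which is how its measurability is obtained. *)
Lemma restrict_twist n (f : affine R n) N (A : set 'rV[R]_n)
    (u u' : 'rV[R]_n -> \bar R) : f.2 != 0 ->
  (forall x, A x -> 0 < f x) ->
  (forall x, A x -> u x = (((f x)^-1 ^+ N)%:E * u' (twist_map f x))%E) ->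
  u' \_ (twist_map f @` A) =
  untwist f ((fun x => (f x ^+ N)%:E * u x)%E \_ A).
Proof.
move=> f2 fA uu'; apply/funext => x'; rewrite /untwist /patch.
case: ifPn => [/set_mem|/negP nTA]; last first.
  case: ifPn => // t0; case: ifPn => // /set_mem Ax.
  case: nTA; apply: mem_set; exists ((untwist_factor f x')^-1 *: x') => //.
  rewrite /twist_map affine_untwist// ?gt_eqF// invrK scalerA.
  by rewrite mulfV ?scale1r// gt_eqF.
case=> x Ax <-; have fx := fA _ Ax.
rewrite untwist_factor_twist// ?gt_eqF// invr_gt0 fx invrK /twist_map scalerA.
rewrite mulfV ?gt_eqF// scale1r mem_set// uu'// muleA -EFinM -exprMn.
by rewrite mulfV ?gt_eqF// expr1n mul1e.
Qed.

Lemma restrict_weight n (f : affine R n) N (A : set 'rV[R]_n)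
    (u : 'rV[R]_n -> \bar R) x : (forall x, A x -> 0 < f x) ->
  (u \_ A) x = (((f x)^-1 ^+ N)%:E *
    ((fun x => (f x ^+ N)%:E * u x) \_ A) x)%E.
Proof.
move=> fA; rewrite /patch; case: ifPn => [|_]; last by rewrite mule0.
rewrite inE => /fA fx; rewrite muleA -EFinM -exprMn.
by rewrite mulVf ?gt_eqF// expr1n mul1e.
Qed.

Lemma dotr_cons n (b t : R) (a y : 'rV[R]_n) :
  dotr (rV_cons (b : mR, a)) (rV_cons (t : mR, y)) = b * t + dotr a y.
Proof.
rewrite /dotr big_ord_recl !mxE unlift_none; congr (_ + _).
by apply: eq_bigr => i _; rewrite !mxE liftK.
Qed.

Lemma chart_cons n (b : R) (a x : 'rV[R]_n) :
  chart (rV_cons (b : mR, a)) ord0 x =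
  rV_cons ((1 - dotr a x) / b : mR, x).
Proof.
apply/rowP => k; rewrite !mxE; case: (unliftP ord0 k) => [k' _|_] //=.
rewrite unlift_none opprD opprK addrC; congr ((_ - _) / _).
by apply: eq_bigr => i _; rewrite mxE liftK.
Qed.

(* [twist_map f] is the chart change between the hyperplanes [t = 1] and
   [f.2 * t + dotr f.1 y = 1] of the space of the [(t, y)]. *)
Lemma ge0_integral_twist n (f : affine R n) (D : set 'rV[R]_n)
    (u u' : 'rV[R]_n -> \bar R) : f.2 != 0 -> measurable D ->
  (forall x, D x -> 0 < f x) -> measurable_fun D u ->
  (forall x, D x -> 0 <= u x)%E ->
  (forall x, D x -> u x = (((f x)^-1 ^+ n.+1)%:E * u' (twist_map f x))%E) ->
  (`|f.2|^-1%:E * \int[lebesgue_rV n]_(x in twist_map f @` D) u' x =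
   \int[lebesgue_rV n]_(x in D) u x)%E.
Proof.
move=> f2 mD fD mu u0 uu'.
rewrite integral_mkcond [RHS]integral_mkcond (restrict_twist f2 fD uu').
set k := _ \_ D.
have mk : measurable_fun setT k by exact: measurable_weight.
have k0 x : (0 <= k x)%E.
  apply: erestrict_ge0 => y Dy; rewrite mule_ge0 ?u0// lee_fin.
  by rewrite exprn_ge0 ?ltW ?fD.
have kf x : f x <= 0 -> k x = 0%E.
  rewrite /k /patch; case: ifPn => // /set_mem/fD.
  by rewrite ltNge => /negbTE ->.
pose p : 'rV[R]_n.+1 := rV_cons (1 : mR, 0).
pose p' : 'rV[R]_n.+1 := rV_cons (f.2 : mR, f.1).
pose tl (z : 'rV[R]_n.+1) : 'rV[R]_n := \row_i z ord0 (lift ord0 i).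
have tlZ c z : tl (c *: z) = c *: tl z by apply/rowP => i; rewrite !mxE.
have zE (z : 'rV[R]_n.+1) : z = rV_cons (z ord0 ord0 : mR, tl z).
  apply/rowP => i; rewrite mxE.
  by case: (unliftP ord0 i) => [i' ->|->] //; rewrite mxE.
have tlE (t : R) y : tl (rV_cons (t : mR, y)) = y.
  by apply/rowP => i; rewrite !mxE liftK.
have hdE (t : R) (y : 'rV[R]_n) : rV_cons (t : mR, y) ord0 ord0 = t.
  by rewrite mxE unlift_none.
have pE z : dotr p z = z ord0 ord0.
  rewrite [z in LHS]zE dotr_cons mul1r /dotr big1 ?addr0// => i _.
  by rewrite mxE mul0r.
have p'E z : dotr p' z = f.2 * z ord0 ord0 + dotr f.1 (tl z).
  by rewrite [z in LHS]zE dotr_cons.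
(* The extension of [k], homogeneous of degree 0, from the slice [t = 1] to the half-space
   [t > 0]. *)
pose K (z : 'rV[R]_n.+1) : \bar R :=
  if 0 < z ord0 ord0 then k ((z ord0 ord0)^-1 *: tl z) else 0%E.
have p0 : p ord0 ord0 != 0 by rewrite hdE oner_neq0.
have p'0 : p' ord0 ord0 != 0 by rewrite hdE.
have mK : measurable_fun setT K.
  have m0 : measurable_fun setT (fun z : 'rV[R]_n.+1 => z ord0 ord0).
    exact: measurable_coord.
  apply: measurable_fun_ifT => //; first exact: measurable_fun_ltr.
  apply: (measurableT_comp mk); apply: measurable_fun_scale => //.
    by apply: measurableT_comp => //; exact: measurable_invr.
  apply: measurable_fun_rV => i.
  rewrite (_ : (fun t => _) = (fun z : 'rV[R]_n.+1 => z ord0 (lift ord0 i))).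
    exact: measurable_coord.
  by apply/funext => z; rewrite mxE.
have K0 z : (0 <= K z)%E by rewrite /K; case: ifP.
have Kp z : dotr p z <= 0 -> K z = 0%E.
  by rewrite pE /K; case: ltP.
(* For [t > 0] one has [dotr p' (t, y) = t * f (y / t)], so a nonpositive value forces [f <= 0] at
   [y / t], where [k] vanishes. *)
have Kp' z : dotr p' z <= 0 -> K z = 0%E.
  rewrite p'E /K; case: ltP => // z0 le0; apply: kf.
  rewrite affine_evalE dotrZr -(pmulr_rle0 _ z0) mulrDr mulrA mulfV ?gt_eqF//.
  by rewrite mul1r addrC mulrC.
have Kc c z : 0 < c -> K (c *: z) = K z.
  move=> c0; rewrite /K mxE pmulr_rgt0//; case: ltP => // z0.
  by rewrite tlZ scalerA invfM mulrC mulrA mulfV ?mul1r// gt_eqF.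
(* On the slice [t = 1] the form [dotr p'] is [f]; the ambient dimension gives the exponent [n.+1],
   and the leading coefficient of [p'] gives [|f.2|^-1]. *)
have := integral_chart_change p0 p'0 mK K0 Kp Kp' Kc.
rewrite !hdE normr1 invr1 mul1e.
have Kp'E x : K (chart p' ord0 x) = untwist f k x.
  by rewrite /K chart_cons hdE tlE.
rewrite (eq_integral (untwist f k) (fun x => K (chart p' ord0 x)))//.
move=> ->; apply: eq_integral => x _.
rewrite chart_cons (_ : dotr 0 x = 0); last first.
  by rewrite /dotr big1// => i _; rewrite mxE mul0r.
rewrite subr0 divr1 p'E hdE tlE mulr1 addrC -affine_evalE /K hdE tlE ltr01.
by rewrite invr1 scale1r -restrict_weight.
Qed.

Lemma ge0_integral_hyperplane m (L : affine R m) j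
    (g : 'rV[R]_m -> \bar R) :
  [pick j | L.1 ord0 j != 0] = Some j ->
  measurable_fun setT g -> (forall x, 0 <= g x)%E ->
  (\int[hyperplane_measure L]_x g x = `|L.1 ord0 j|^-1%:E *
   \int[lebesgue_rV m.-1]_y g (hyperplane_graph L j y))%E.
Proof.
move=> Lj mg g0.
have c0 : 0 <= `|L.1 ord0 j|^-1 by rewrite invr_ge0.
pose c : {nonneg R} := NngNum c0.
pose nu := measure_function_pushforward__canonical__measure_function_Measure
  (lebesgue_rV m.-1) (measurable_hyperplane_graph L j).
transitivity (\int[mscale c nu]_x g x)%E.
  apply: eq_measure_integral => A mA _.
  rewrite -[LHS]/(hyperplane_measure L A) /hyperplane_measure.
  by rewrite Lj.
rewrite ge0_integral_mscale//; congr (_ * _)%E.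
have := ge0_integral_pushforward (measurable_hyperplane_graph L j)
  (lebesgue_rV m.-1) measurableT mg (fun x _ => g0 x).
by rewrite preimage_setT => <-.
Qed.

End twist_integral.

(** * The twist on facet integrals *)

Section facet_twist.
Context {R : realType}.
Local Notation mR := (measurableTypeR R).

Lemma hyperplane_measure_eq0 m (L : affine R m) D (g : 'rV[R]_m -> \bar R) :
  L.1 = 0 -> (\int[hyperplane_measure L]_(x in D) g x = 0)%E.
Proof.
move=> L0; rewrite (eq_measure_integral mzero) ?integral_measure_zero//.
move=> A mA _; rewrite -[LHS]/(hyperplane_measure L A) /hyperplane_measure.
by case: pickP => // j; rewrite L0 mxE eqxx.
Qed.

Lemma ex_pick_neq0 m (v : 'rV[R]_m) : v != 0 ->
  exists2 j, [pick j | v ord0 j != 0] = Some j & v ord0 j != 0.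
Proof.
move=> v0; case: pickP => [j vj|v00]; first by exists j.
by case/eqP: v0; apply/rowP => j; rewrite mxE; apply/eqP/negPn; rewrite v00.
Qed.

Lemma dotrDl n (p q y : 'rV[R]_n) : dotr (p + q) y = dotr p y + dotr q y.
Proof.
rewrite /dotr -big_split; apply: eq_bigr => k _.
by rewrite mxE mulrDl.
Qed.

Lemma dotrZl n (p y : 'rV[R]_n) c : dotr (c *: p) y = c * dotr p y.
Proof.
by rewrite /dotr mulr_sumr; apply: eq_bigr => k _; rewrite mxE mulrA.
Qed.

(** Dividing the equation [L y = 0] by [- L.2] brings it to the form [dotr p y = 1]. *)
Lemma hyperplane_graph_chart n (L : affine R n.+1) j y : L.2 != 0 ->
  hyperplane_graph L j y = chart (- L.2^-1 *: L.1) j y.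
Proof.
move=> L2; apply/rowP => k; rewrite !mxE; case: (unliftP j k) => // _.
(* With a zero [j]-th coefficient both entries are 0, because the inverse of 0 is 0. *)
have [->|Lj] := eqVneq (L.1 ord0 j) 0; first by rewrite mulr0 invr0 !mulr0.
have -> : \sum_k' (- L.2^-1 *: L.1) ord0 (lift j k') * y ord0 k' =
    - L.2^-1 * \sum_k' L.1 ord0 (lift j k') * y ord0 k'.
  by rewrite mulr_sumr; apply: eq_bigr => i _; rewrite !mxE mulrA.
by rewrite /=; field; rewrite Lj L2.
Qed.

Section twisted_facet.
Variables (n : nat) (f L L' : affine R n.+1) (A : set 'rV[R]_n.+1).
Variables (u u' : 'rV[R]_n.+1 -> \bar R) (j j' : 'I_n.+1).
Hypotheses (f2 : 0 < f.2) (L1E : L.1 = L'.1 + L'.2 *: f.1)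
  (L2E : L.2 = L'.2 * f.2).
Hypotheses (mA : measurable A) (LA : forall x, A x -> L x = 0)
  (fA : forall x, A x -> 0 < f x) (mu : measurable_fun A u)
  (u0 : forall x, A x -> (0 <= u x)%E)
  (uu' : forall x, A x ->
    u x = (((f x)^-1 ^+ n.+1)%:E * u' (twist_map f x))%E).
Hypotheses (Lj : L.1 ord0 j != 0) (Lj' : L'.1 ord0 j' != 0).

Let k : 'rV[R]_n.+1 -> \bar R := (fun x => (f x ^+ n.+1)%:E * u x)%E \_ A.

Let mk : measurable_fun setT k. Proof. exact: measurable_weight. Qed.

Let k0 x : (0 <= k x)%E.
Proof.
rewrite /k; apply: erestrict_ge0 => y Ay; rewrite mule_ge0 ?u0// lee_fin.
by rewrite exprn_ge0// ltW// fA.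
Qed.

(** [L1E] and [L2E] are [L' (x / f x) = L x / f x] read on coefficients. They give
    [p' = f.2 *: p + f.1] for the normalised equations, so both hyperplanes are charts in the same
    space and [integral_chart_change] applies without an extra dimension. *)
Lemma ge0_integral_facet_away : L.2 != 0 ->
  (f.2^-1%:E * (`|L'.1 ord0 j'|^-1%:E *
     \int[lebesgue_rV n]_y untwist f k (hyperplane_graph L' j' y)) =
   `|L.1 ord0 j|^-1%:E *
     \int[lebesgue_rV n]_y (u \_ A) (hyperplane_graph L j y))%E.
Proof.
move=> L20; have L2' : L'.2 != 0.
  by apply: contra_neq L20 => L2'; rewrite L2E L2' mul0r.
pose p := - L.2^-1 *: L.1; pose p' := - L'.2^-1 *: L'.1.
have pj : p ord0 j != 0 by rewrite mxE mulf_neq0// oppr_eq0 invr_eq0.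
have pj' : p' ord0 j' != 0 by rewrite mxE mulf_neq0// oppr_eq0 invr_eq0.
have pp' z : dotr p' z = f.2 * dotr p z + dotr f.1 z.
  rewrite !dotrZl L1E dotrDl dotrZl L2E; field.
  by rewrite L2' gt_eqF.
pose K z : \bar R := if 0 < dotr p z then k ((dotr p z)^-1 *: z) else 0%E.
have mK : measurable_fun setT K.
  have mp : measurable_fun setT (fun z : 'rV[R]_n.+1 => dotr p z).
    exact: measurable_fun_dotr.
  apply: measurable_fun_ifT => //; first exact: measurable_fun_ltr.
  apply: (measurableT_comp mk); apply: measurable_fun_scale => //.
  by apply: measurableT_comp => //; exact: measurable_invr.
have K0 z : (0 <= K z)%E by rewrite /K; case: ifP.
have Kp z : dotr p z <= 0 -> K z = 0%E by rewrite /K; case: ltP.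
have Kp' z : dotr p' z <= 0 -> K z = 0%E.
  rewrite pp' /K; case: ltP => // z0 le0.
  rewrite /k /patch; case: ifPn => // /set_mem/fA; rewrite affine_evalE dotrZr.
  rewrite -(pmulr_rgt0 _ z0) mulrDr mulrA mulfV ?gt_eqF// mul1r addrC mulrC.
  by rewrite ltNge le0.
have Kc c z : 0 < c -> K (c *: z) = K z.
  move=> c0; rewrite /K dotrZr pmulr_rgt0//; case: ltP => // z0.
  by rewrite scalerA invfM mulrC mulrA mulfV ?mul1r// gt_eqF.
have := integral_chart_change pj pj' mK K0 Kp Kp' Kc.
rewrite (eq_integral (fun y => untwist f k (hyperplane_graph L' j' y))
  (fun y => K (chart p' j' y))); last first.
  move=> y _; rewrite hyperplane_graph_chart//; rewrite -/p'.
  (* On the twisted hyperplane [dotr p' = 1], and solving [pp'] for [dotr p] gives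
     [untwist_factor f]. *)
  rewrite /K /untwist (_ : untwist_factor f _ = dotr p (chart p' j' y))//.
  rewrite /untwist_factor -[X in X - _](dotr_chart y pj') pp'.
  by rewrite addrK mulrC mulKf// gt_eqF.
rewrite (eq_integral (fun y => (u \_ A) (hyperplane_graph L j y))
  (fun y => _ * K (chart p j y))%E); last first.
  move=> y _; rewrite hyperplane_graph_chart//; rewrite -/p.
  rewrite pp' /K dotr_chart// ltr01 invr1 scale1r mulr1 addrC -affine_evalE.
  by rewrite [RHS](restrict_weight n.+1 _ _ fA).
(* Both normalisations carry a factor [|L.2|], which cancels; [L.2 = L'.2 * f.2] leaves [f.2^-1] on
   the twisted side. *)
have p'E : `|p' ord0 j'|^-1 = `|L.2| * (f.2^-1 * `|L'.1 ord0 j'|^-1).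
  rewrite mxE normrM normrN normfV L2E normrM (gtr0_norm f2).
  by field; rewrite !normr_eq0 Lj' L2' gt_eqF.
have pE : `|p ord0 j|^-1 = `|L.2| * `|L.1 ord0 j|^-1.
  rewrite mxE normrM normrN normfV.
  by field; rewrite !normr_eq0 Lj L20.
rewrite p'E pE !EFinM -!muleA => /(congr1 (fun x => `|L.2|^-1%:E * x)%E).
by rewrite !muleA -!EFinM mulVf ?normr_eq0// !mul1r !EFinM -!muleA.
Qed.

(** Here [L' = L] is a linear form, and its kernel is parametrised by the linear map [gr]. The twist
    by [f] becomes the twist of [n]-space by [f \o gr], whose exponent [n.+1] is the required
    one. *)
Lemma ge0_integral_facet_through : L.2 = 0 -> j = j' ->
  (f.2^-1%:E * (`|L'.1 ord0 j'|^-1%:E *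
     \int[lebesgue_rV n]_y untwist f k (hyperplane_graph L' j' y)) =
   `|L.1 ord0 j|^-1%:E *
     \int[lebesgue_rV n]_y (u \_ A) (hyperplane_graph L j y))%E.
Proof.
move=> L20 jj'; rewrite -jj'.
have L2' : L'.2 = 0.
  by apply/eqP; move/eqP: L2E; rewrite L20 eq_sym mulf_eq0 (gt_eqF f2) orbF.
have LL' : L' = L.
  apply: injective_projections; last by rewrite L20.
  by rewrite L1E L2' scale0r addr0.
rewrite LL' muleCA; congr (_ * _)%E.
pose gr := @hyperplane_graph R n.+1 L j.
pose pr (x : 'rV[R]_n.+1) : 'rV[R]_n := \row_i x ord0 (lift j i).
have grK y : pr (gr y) = y by apply/rowP => i; rewrite !mxE liftK.
have prK x : L x = 0 -> gr (pr x) = x.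
  move=> Lx; apply/rowP => i; rewrite mxE.
  case: (unliftP j i) => [i' ->|->]; first by rewrite mxE.
  move: Lx; rewrite /affine_eval (bigD1_ord j)//= => /eqP.
  rewrite -addrA addr_eq0 => /eqP Lx; apply: (mulfI Lj); rewrite mulrC divfK//.
  rewrite Lx; congr (- (_ + _)); apply: eq_bigr => k' _.
  by rewrite mxE.
have grZ c y : gr (c *: y) = c *: gr y.
  apply/rowP => i; rewrite !mxE; case: (unliftP j i) => [i' _|_].
    by rewrite mxE.
  have -> : \sum_i L.1 ord0 (lift j i) * (c *: y) ord0 i =
      c * \sum_i L.1 ord0 (lift j i) * y ord0 i.
    by rewrite mulr_sumr; apply: eq_bigr => k' _; rewrite mxE mulrCA.
  by rewrite L20; ring.
have mgr : measurable_fun setT gr by exact: measurable_hyperplane_graph.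
(* The coefficients of [f \o gr], found by substituting the solved [j]-th coordinate; the constant
   stays [f.2] since [gr] is linear. *)
pose fH : affine R n := (\row_i (f.1 ord0 (lift j i) -
  f.1 ord0 j / L.1 ord0 j * L.1 ord0 (lift j i)), f.2).
have fHE y : fH y = f (gr y).
  rewrite !affine_evalE; congr (_ + _); rewrite /dotr (bigD1_ord j)//=.
  rewrite mxE unlift_none L20 addr0 [X in _ = _ + X](eq_bigr
    (fun i => f.1 ord0 (lift j i) * y ord0 i)); last first.
    by move=> i _; rewrite mxE liftK.
  rewrite mulNr mulrN mulrA mulrAC [X in - X + _]mulr_sumr -sumrN -big_split.
  by apply: eq_bigr => i _; rewrite /= mxE; ring.
have Tgr y : gr (twist_map fH y) = twist_map f (gr y).
  by rewrite /twist_map grZ fHE.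
pose D := gr @^-1` A.
have mD : measurable D by rewrite -[D]setTI; exact: mgr.
have mugr : measurable_fun D (u \o gr).
  apply: (measurable_comp mA) => //; last exact: measurable_funTS.
  by move=> x [y Dy <-].
have uu'H y : D y -> (u \o gr) y =
    (((fH y)^-1 ^+ n.+1)%:E * (u' \o gr) (twist_map fH y))%E.
  by move=> Dy; rewrite /= uu'// fHE Tgr.
have := ge0_integral_twist (lt0r_neq0 f2 : fH.2 != 0) mD
  (fun y Dy => ltac:(by rewrite fHE; exact: fA) : 0 < fH y) mugr
  (fun y Dy => u0 Dy) uu'H.
rewrite [`|fH.2|]gtr0_norm// integral_mkcond [RHS]integral_mkcond.
rewrite (eq_integral (fun y => untwist f k (gr y))).
  move=> ->; apply: eq_integral => y _; rewrite /patch.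
  by congr (if _ then _ else _); apply/idP/idP => /set_mem Ay; exact: mem_set.
move=> y' _.
(* It remains to match the two image sets under [gr]; [pr] inverts [gr] on the hyperplane. *)
rewrite -(restrict_twist (lt0r_neq0 f2) fA uu') /patch.
congr (if _ then _ else _); apply/idP/idP => /set_mem Ay; apply: mem_set.
  by case: Ay => y Dy <-; exists (gr y) => //; rewrite Tgr.
case: Ay => x Ax Txy; exists (pr x).
  by rewrite /D /= prK// LA.
by rewrite -[LHS]grK Tgr prK ?LA// Txy grK.
Qed.

End twisted_facet.

Lemma ge0_integral_facet_twist m (f L L' : affine R m) (A : set 'rV[R]_m)
    (u u' : 'rV[R]_m -> \bar R) :
  0 < f.2 -> L.1 = L'.1 + L'.2 *: f.1 -> L.2 = L'.2 * f.2 ->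
  measurable A -> (forall x, A x -> L x = 0) -> (forall x, A x -> 0 < f x) ->
  measurable_fun A u -> (forall x, A x -> 0 <= u x)%E ->
  (forall x, A x -> u x = (((f x)^-1 ^+ m)%:E * u' (twist_map f x))%E) ->
  (f.2^-1%:E * \int[hyperplane_measure L']_(x in twist_map f @` A) u' x =
   \int[hyperplane_measure L]_(x in A) u x)%E.
Proof.
move=> f2 L1E L2E mA LA fA mu u0 uu'.
have [->|/set0P[x0 Ax0]] := eqVneq A set0.
  by rewrite image_set0 !integral_set0 mule0.
have dot0 (y : 'rV[R]_m) : dotr 0 y = 0.
  by rewrite /dotr big1// => i _; rewrite mxE mul0r.
(* A constant label that vanishes at [x0] is zero; then so is [L'], and both measures take their
   default value zero. *)
have [L10|L10] := eqVneq L.1 0.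
  have L20 : L.2 = 0 by have := LA _ Ax0; rewrite affine_evalE L10 dot0 add0r.
  have L2' : L'.2 = 0.
    by apply/eqP; move/eqP: L2E; rewrite L20 eq_sym mulf_eq0 (gt_eqF f2) orbF.
  rewrite !hyperplane_measure_eq0 ?mule0//.
  by move: L1E; rewrite L10 L2' scale0r addr0.
(* A constant [L'] would make [L] equal to [L'.2] times [f]; vanishing at [x0], where [f] is
   positive, forces [L'.2 = 0] and hence [L.1 = 0]. *)
have [L10'|L10'] := eqVneq L'.1 0.
  case/eqP: L10; rewrite L1E L10' add0r.
  have : L'.2 * f x0 = 0.
    have := LA _ Ax0; rewrite !affine_evalE L1E L10' add0r dotrZl L2E.
    by rewrite mulrDr.
  move/eqP; rewrite mulf_eq0 (gt_eqF (fA _ Ax0)) orbF => /eqP ->.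
  exact: scale0r.
have [j Lj Lj0] := ex_pick_neq0 L10; have [j' Lj' Lj0'] := ex_pick_neq0 L10'.
rewrite integral_mkcond [RHS]integral_mkcond.
rewrite (restrict_twist (lt0r_neq0 f2) fA uu').
rewrite (ge0_integral_hyperplane Lj'); last 2 first.
- by apply: measurable_untwist; exact: measurable_weight.
- move=> x; rewrite /untwist; case: ifP => // _; apply: erestrict_ge0 => y Ay.
  by rewrite mule_ge0 ?u0// lee_fin exprn_ge0// ltW// fA.
rewrite (ge0_integral_hyperplane Lj); last 2 first.
- exact/(measurable_restrictT _ mA).
- exact: erestrict_ge0.
case: m => [|n] in f L L' A u u' f2 L1E L2E mA LA fA mu u0 uu' x0 Ax0 dot0
  L10 L10' j Lj Lj0 j' Lj' Lj0' *.
  by case: j {Lj Lj0}.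
have [L20|L20] := eqVneq L.2 0; last exact: ge0_integral_facet_away.
apply: (ge0_integral_facet_through (u' := u')) => //.
(* The selected index depends only on the differential, which the two labels share on a hyperplane
   through the origin; hence [j = j']. *)
have L2' : L'.2 = 0.
  by apply/eqP; move/eqP: L2E; rewrite L20 eq_sym mulf_eq0 (gt_eqF f2) orbF.
have LL : L'.1 = L.1 by rewrite L1E L2' scale0r addr0.
by move: Lj'; rewrite LL Lj => -[].
Qed.

End facet_twist.

(** * From nonnegative to signed integrands *)

Section Rintegral_twist.
Context {R : realType}.

(** The signs [e = 1] and [e = -1] give the positive and negative parts. If one of them has infinite
    integral, the positive factor [c] keeps it infinite, and [fine] yields 0 on both sides. *)
Lemma Rintegral_posneg d d' (T : measurableType d) (T' : measurableType d')
    (mu : {measure set T -> \bar R}) (mu' : {measure set T' -> \bar R})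
    (D : set T) (D' : set T') (u : T -> R) (u' : T' -> R) (c : R) : 0 < c ->
  (forall e : R, (`|e| = 1)%R ->
    c%:E * \int[mu']_(x in D') (Num.max (e * u' x) 0)%R%:E =
    \int[mu]_(x in D) (Num.max (e * u x) 0)%R%:E)%E ->
  c * \int[mu']_(x in D') u' x = \int[mu]_(x in D) u x.
Proof.
move=> c0 H; rewrite /Rintegral (integralE _ D) (integralE _ D').
have posE T0 (v : T0 -> R) :
    ((fun x => (v x)%:E)^\+)%E = fun x => (Num.max (1 * v x) 0)%:E.
  by apply/funext => x; rewrite funeposE mul1r -EFin_max.
have negE T0 (v : T0 -> R) :
    ((fun x => (v x)%:E)^\-)%E = fun x => (Num.max (-1 * v x) 0)%:E.
  by apply/funext => x; rewrite funenegE mulN1r EFin_max.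
rewrite !posE !negE -!H ?normrN ?normr1//.
have fineE (a b : \bar R) : (0 <= a)%E -> (0 <= b)%E ->
    c * fine (a - b)%E = fine (c%:E * a - c%:E * b)%E.
  move: a b => [a| |] [b| |] //= _ _;
  by rewrite ?gt0_muley ?lte_fin//= ?mulr0 ?mulrBr.
by apply: fineE; apply: integral_ge0 => x _; rewrite lee_fin le_max lexx orbT.
Qed.

Lemma measurable_fun_max0 d (T : measurableType d) D (u : T -> R) (e : R) :
  measurable_fun D u ->
  measurable_fun D (fun x => (Num.max (e * u x) 0)%R%:E).
Proof.
move=> mu; apply/measurable_EFinP; apply: measurable_maxr => //.
exact: measurable_funM.
Qed.

Lemma Rintegral_twist n (f : affine R n) (D : set 'rV[R]_n)
    (u u' : 'rV[R]_n -> R) : 0 < f.2 -> measurable D ->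
  (forall x, D x -> 0 < f x) -> measurable_fun D u ->
  (forall x, D x -> u x = (f x)^-1 ^+ n.+1 * u' (twist_map f x)) ->
  f.2^-1 * \int[lebesgue_rV n]_(x in twist_map f @` D) u' x =
  \int[lebesgue_rV n]_(x in D) u x.
Proof.
move=> f2 mD fD mu uu'; apply: Rintegral_posneg; first by rewrite invr_gt0.
move=> e _; rewrite -[in f.2^-1](gtr0_norm f2); apply: ge0_integral_twist => //.
- exact: lt0r_neq0.
- exact: measurable_fun_max0.
- by move=> x _; rewrite lee_fin le_max lexx orbT.
- move=> x Dx; rewrite -EFinM maxr_pMr ?mulr0; last first.
    by rewrite exprn_ge0// invr_ge0 ltW// fD.
  by rewrite uu'// mulrCA.
Qed.

Lemma Rintegral_facet_twist m (f L L' : affine R m) (A : set 'rV[R]_m)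
    (u u' : 'rV[R]_m -> R) :
  0 < f.2 -> L.1 = L'.1 + L'.2 *: f.1 -> L.2 = L'.2 * f.2 ->
  measurable A -> (forall x, A x -> L x = 0) -> (forall x, A x -> 0 < f x) ->
  measurable_fun A u ->
  (forall x, A x -> u x = (f x)^-1 ^+ m * u' (twist_map f x)) ->
  f.2^-1 * \int[hyperplane_measure L']_(x in twist_map f @` A) u' x =
  \int[hyperplane_measure L]_(x in A) u x.
Proof.
move=> f2 L1E L2E mA LA fA mu uu'.
apply: Rintegral_posneg; first by rewrite invr_gt0.
move=> e _; apply: ge0_integral_facet_twist => //.
- exact: measurable_fun_max0.
- by move=> x _; rewrite lee_fin le_max lexx orbT.
- move=> x Ax; rewrite -EFinM maxr_pMr ?mulr0; last first.
    by rewrite exprn_ge0// invr_ge0 ltW// fA.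
  by rewrite uu'// mulrCA.
Qed.

End Rintegral_twist.

(** * Borel sets, balls and integrability in spaces of row vectors *)

Section rV_topology.
Context {R : realType}.

Lemma ball_rVE n (x : 'rV[R]_n) (e : R) : 0 < e ->
  ball x e = [set y | forall i, ball (x ord0 i) e (y ord0 i)].
Proof.
move=> e0; apply/seteqP; split=> y.
  by move=> [_ xy] i; exact: xy.
by move=> xy; split => // i j; rewrite ord1; exact: xy.
Qed.

Lemma measurable_ball_rV n (x : 'rV[R]_n) (e : R) : measurable (ball x e).
Proof.
have [e0|e0] := ltP 0 e; last first.
  rewrite (_ : ball x e = set0) -?subset0// => y [].
  by rewrite ltNge e0.
have -> : ball x e = \bigcap_(i in [set: 'I_n])
    [set y : 'rV[R]_n | ball (x ord0 i) e (y ord0 i)].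
  by rewrite ball_rVE//; apply/seteqP; split=> y xy i *; exact: xy.
apply: fin_bigcap_measurable => // i _.
rewrite -[X in measurable X]setTI; apply: measurable_coord => //.
exact: measurable_ball.
Qed.

(** The sigma-algebra is generated by coordinates, so an open set is written as a countable union of
    balls with rational centre and radius. *)
Lemma open_rV_measurable n (U : set 'rV[R]_n) : open U -> measurable U.
Proof.
move=> oU.
pose B (qr : 'rV[rat]_n * rat) : set 'rV[R]_n :=
  ball (map_mx ratr qr.1 : 'rV[R]_n) (ratr qr.2 : R).
rewrite (_ : U = \bigcup_qr if `[<B qr `<=` U>] then B qr else set0).
  apply: countable_bigcupT_measurable => [|qr]; first exact: countableP.
  by case: ifP => // _; exact: measurable_ball_rV.
apply/seteqP; split=> x; last first.
  by move=> [qr _]; case: ifPn => // /asboolP BU /BU.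
move=> Ux; move: oU; rewrite openE => /(_ _ Ux) /nbhs_ballP[e /= e0 eU].
(* A radius below [e / 2] and a centre within that radius of [x] keep the rational ball inside
   [ball x e]. *)
have [r] : exists q : rat, ratr q \in `](0 : R), (e / 2)[.
  by apply: rat_in_itvoo; rewrite divr_gt0.
rewrite in_itv/= => /andP[r0 re].
have /choice[q qx] : forall i, exists q : rat,
    ratr q \in `](x ord0 i - ratr r), (x ord0 i + ratr r)[.
  by move=> i; apply: rat_in_itvoo; lra.
have xB : ball (map_mx ratr (\row_i q i) : 'rV[R]_n) (ratr r : R) x.
  rewrite ball_rVE// => i; rewrite !mxE.
  have := qx i; rewrite in_itv/= => /andP[q1 q2].
  by rewrite /ball/= ltr_norml; apply/andP; split; lra.
exists (\row_i q i, r) => //; rewrite ifT//; apply/asboolP => y yB.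
apply: eU; apply: (@le_ball _ _ _ (ratr r + ratr r)); first lra.
by apply: ball_triangle yB; exact: ball_sym.
Qed.

Lemma continuous_rV_measurable n (D : set 'rV[R]_n) (g : 'rV[R]_n -> R) :
  measurable D -> {within D, continuous g} -> measurable_fun D g.
Proof.
move=> mD /continuousP cg; apply: (measurability _ (RGenOpens.measurableE R)).
move=> _ [_ [a [b ->] <-]].
have /open_subspaceP[V oV VD] : open (from_subspace D g @^-1` `]a, b[).
  exact/cg/interval_open.
rewrite setIC -VD; apply: measurableI => //; exact: open_rV_measurable.
Qed.

(** Balls are cubes for the sup norm. The value gives finite measure to bounded measurable sets and
    positive measure to balls. *)
Lemma lebesgue_rV_ball n (x : 'rV[R]_n) (e : R) : 0 < e ->
  lebesgue_rV n (ball x e) = ((2 * e) ^+ n)%:E.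
Proof.
move=> e0; elim: n => [|n IHn] in x *.
  by rewrite /= diracE mem_set// ball_rVE// => -[].
rewrite /= /lebesgue_rV_succ /pushforward.
pose x' : 'rV[R]_n := \row_i x ord0 (lift ord0 i).
rewrite (_ : _ @^-1` _ = ball (x ord0 ord0) e `*` ball x' e).
  rewrite product_measure1E ?IHn//; last 2 first.
  - exact: measurable_ball.
  - exact: measurable_ball_rV.
  rewrite [X in (X * _)%E]lebesgue_measure_ball ?ltW//.
  by rewrite -EFinM exprS mulr_natl.
rewrite !ball_rVE//; apply/seteqP; split=> -[t y] /=.
  move=> H; split; first by have := H ord0; rewrite mxE unlift_none.
  by move=> i; have := H (lift ord0 i); rewrite !mxE liftK.
move=> [H0 H] i; rewrite mxE; case: (unliftP ord0 i) => [k ->|->] //=.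
by have := H k; rewrite mxE.
Qed.

Lemma compact_rV_bounded n (D : set 'rV[R]_n) : compact D ->
  exists2 M : R, 0 < M & D `<=` ball 0 M.
Proof.
move=> /compact_bounded[M [Mr MD]].
exists (`|M| + 1 + 1); first by rewrite -addrA ltr_wpDl.
move=> x Dx; rewrite -ball_normE /= sub0r normrN.
have := MD (`|M| + 1); rewrite (le_lt_trans (ler_norm M)) ?ltrDl//.
by move=> /(_ isT x Dx) /le_lt_trans; apply; rewrite ltrDl.
Qed.

Lemma continuous_compact_rV_integrable n (D : set 'rV[R]_n)
    (g : 'rV[R]_n -> R) : measurable D -> compact D ->
  {within D, continuous g} -> (lebesgue_rV n).-integrable D (EFin \o g).
Proof.
move=> mD cD cg; apply: measurable_bounded_integrable => //.
- have [M M0 DM] := compact_rV_bounded cD.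
  apply: (@le_lt_trans _ _ (lebesgue_rV n (ball 0 M))).
    by apply: le_measure; rewrite ?inE//; exact: measurable_ball_rV.
  by rewrite lebesgue_rV_ball// ltry.
- exact: continuous_rV_measurable.
- have /compact_bounded[M [_ mrt]] := continuous_compact cg cD.
  by exists M; split; rewrite ?num_real // => ? ? ? ?; exact: mrt.
Qed.

Lemma affine_continuous n (f : affine R n) : continuous (f : 'rV[R]_n -> R).
Proof.
pose g k (x : 'rV[R]_n) : R^o := f.1 ord0 k * x ord0 k.
have gC k : continuous (g k).
  by move=> x; apply: (@continuousM R 'rV[R]_n (cst (f.1 ord0 k)));
    [exact: cst_continuous|exact: coord_continuous].
have sumC s : continuous (\sum_(k <- s) g k).
  elim: s => [|k s IHs] x; first by rewrite big_nil; exact: cst_continuous.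
  by rewrite big_cons; apply: continuousD; [exact: gC|exact: IHs].
rewrite (_ : affine_eval f = \sum_k g k + cst f.2).
  by move=> x; apply: continuousD; [exact: sumC|exact: cst_continuous].
by apply/funext => x; rewrite fctE fct_sumE.
Qed.

(** A step of length [e / 2] along each axis from an interior point stays in [U] and isolates one
    coefficient at a time. *)
Lemma affine_eq0 n (z : affine R n) (U : set 'rV[R]_n) :
  U° !=set0 -> (forall x, U x -> z x = 0) -> z = 0.
Proof.
move=> [x /nbhs_ballP[e /= e0 eU]] zU.
have zx : z x = 0 by apply: zU; apply: eU; exact: ballxx.
have z1 i : z.1 ord0 i = 0.
  have : z (x + (e / 2) *: delta_mx ord0 i) = 0.
    apply/zU/eU; rewrite ball_rVE// => j; rewrite !mxE /ball /= opprD addNKr.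
    rewrite normrN normrM gtr0_norm ?divr_gt0//.
    by case: eqP => _ /=; rewrite ?mulr1n ?mulr0n ?normr1 ?normr0; lra.
  have -> : z (x + (e / 2) *: delta_mx ord0 i) = z x + z.1 ord0 i * (e / 2).
    rewrite /affine_eval addrAC; congr (_ + _).
    rewrite (eq_bigr (fun k => z.1 ord0 k * x ord0 k +
      z.1 ord0 k * (e / 2) * (k == i)%:R)).
      rewrite big_split/=; congr (_ + _).
      rewrite (bigD1 i)//= eqxx mulr1 big1 ?addr0// => k /negbTE ->.
      by rewrite mulr0.
    by move=> k _; rewrite !mxE mulrDr mulrA.
  rewrite zx add0r => /eqP; rewrite mulf_eq0 => /orP[/eqP//|].
  by rewrite gt_eqF// divr_gt0.
apply: injective_projections; first by apply/rowP => i; rewrite z1 mxE.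
by move: zx; rewrite /affine_eval big1 ?add0r// => i _; rewrite z1 mul0r.
Qed.

End rV_topology.

(** * Twisting affine functions *)

Section twisted_functional.
Context {R : realType} {m : nat}.
Implicit Types (f z : affine R m).

(** The coefficients of [x |-> f x * z (x / f x)]. *)
Definition untwist_affine f z : affine R m :=
  (z.1 + z.2 *: f.1, z.2 * f.2).

Definition twist_affine f z : affine R m :=
  (z.1 - (z.2 / f.2) *: f.1, z.2 / f.2).

Lemma untwist_affine0 f : untwist_affine f 0 = 0.
Proof.
apply: injective_projections; last exact: mul0r.
by rewrite -[LHS]/(0 + 0 *: f.1 : 'rV[R]_m) scale0r addr0.
Qed.

Lemma twist_affineK f z : f.2 != 0 -> untwist_affine f (twist_affine f z) = z.
Proof.
move=> f2; apply: injective_projections => /=; first by rewrite subrK.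
by rewrite divfK.
Qed.

Lemma untwist_affineE f z x : f x != 0 ->
  z (twist_map f x) = untwist_affine f z x / f x.
Proof.
move=> fx; rewrite !affine_evalE /= dotrDl dotrZl /twist_map dotrZr.
rewrite -addrA -mulrDr -affine_evalE.
by field.
Qed.

Lemma affineB z1 z2 x : (z1 - z2 : affine R m) x = z1 x - z2 x.
Proof.
rewrite !affine_evalE /= dotrDl (_ : dotr (- z2.1) x = - dotr z2.1 x).
  by rewrite addrACA opprD.
by rewrite -scaleN1r dotrZl mulN1r.
Qed.

Lemma affine1E x : affine1 R m x = 1.
Proof.
by rewrite /affine_eval big1 ?add0r// => i _; rewrite mxE mul0r.
Qed.

(** Both weights [w - 1] and [w + 1] with [w = m + 2] are brought to this shape, which turns real
    powers into natural ones. *)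
Lemma powR_weight (a : R) (n k : nat) : 0 <= a ->
  a `^ (m%:R + n%:R + k%:R) = a ^+ (m + n + k).
Proof. by move=> a0; rewrite -!natrD powR_mulrn. Qed.

Lemma continuous_affine_quotient f (phi z : affine R m) N
    (D : set 'rV[R]_m) : (forall x, D x -> 0 < f x) ->
  {within D, continuous (fun x => phi x / f x ^+ N * z x)}.
Proof.
move=> fD; apply: continuous_in_subspaceT => x /set_mem Dx.
apply: (@continuousM R 'rV[R]_m (fun x => phi x / f x ^+ N) z);
  last exact: affine_continuous.
apply: (@continuousM R 'rV[R]_m phi (fun x => (f x ^+ N)^-1));
  first exact: affine_continuous.
apply: continuousV; first by rewrite expf_neq0// gt_eqF// fD.
apply: (@continuous_comp _ _ _ (affine_eval f) (fun t => t ^+ N)).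
  exact: affine_continuous.
exact: exprn_continuous.
Qed.

(** * The functional and the extremal affine function of a twisted polytope *)

Section polytope.
Context {d : nat} (Delta : set 'rV[R]_m) (L : 'I_d -> affine R m)
  (f : affine R m) (Delta' : set 'rV[R]_m) (L' : 'I_d -> affine R m).
Hypotheses (Delta_polytope : labelled_polytope Delta L) (Delta_origin : Delta 0)
  (f_pos : forall x, Delta x -> 0 < f x)
  (twist : is_twist f Delta L Delta' L').

Let f2 : 0 < f.2.
Proof.
have := f_pos Delta_origin.
by rewrite /affine_eval big1 ?add0r// => i _; rewrite mxE mulr0.
Qed.

Lemma measurable_polytope : measurable Delta.
Proof.
rewrite (lp_halfspaces Delta_polytope).
rewrite (_ : mkset _ = \bigcap_(i in [set: 'I_d]) [set x | 0 <= L i x]).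
  apply: fin_bigcap_measurable => // i _.
  rewrite -[X in measurable X]setTI.
  rewrite (_ : mkset _ = (L i : 'rV[R]_m -> R) @^-1` `[0, +oo[).
    exact: measurable_fun_affine.
  by apply/seteqP; split => x /=; rewrite in_itv/= andbT.
by apply/seteqP; split => x Lx i *; exact: Lx.
Qed.

Lemma measurable_label_facet i : measurable (label_facet Delta L i).
Proof.
apply: measurableI; first exact: measurable_polytope.
rewrite -[X in measurable X]setTI.
rewrite (_ : mkset _ = (L i : 'rV[R]_m -> R) @^-1` [set 0])//.
exact: measurable_fun_affine.
Qed.

(** [is_twist] gives the equality on [Delta] only; the nonempty interior extends it to the
    coefficients. *)
Lemma is_twist_label i : L i = untwist_affine f (L' i).
Proof.
apply/eqP; rewrite -subr_eq0; apply/eqP.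
apply: (affine_eq0 (lp_interior Delta_polytope)) => x Dx.
have fx := lt0r_neq0 (f_pos Dx).
have [_ /(_ i x Dx)] := twist; rewrite untwist_affineE// affineB.
by move/(mulIf (invr_neq0 fx)) => ->; rewrite subrr.
Qed.

Lemma is_twist_facet i :
  label_facet Delta' L' i = twist_map f @` label_facet Delta L i.
Proof.
have [-> Ltw] := twist; apply/seteqP; split => x'.
  move=> [[x Dx <-]] /=; rewrite Ltw// => /eqP.
  rewrite mulf_eq0 invr_eq0 (gt_eqF (f_pos Dx)) orbF => /eqP Lx.
  by exists x.
by move=> [x [Dx /= Lx] <-]; split; [exists x|rewrite /= Ltw// Lx mul0r].
Qed.

(** The weights match the Jacobians: on facets [f^-(m+1)] is [f^-m] times the [f^-1] of [phi']; in
    the interior [f^-(m+3)] is [f^-(m+1)] times the two factors [f^-1] of [phi'] and [z']. *)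
Lemma DF_functional_twist z z' (phi phi' : 'rV[R]_m -> R) :
  {within Delta, continuous phi} ->
  (forall x, Delta x -> phi' (twist_map f x) = phi x / f x) ->
  (forall x, Delta x -> z' (twist_map f x) = z x / f x) ->
  DF_functional Delta L f (m%:R + 2) z phi =
  f.2^-1 * DF_functional Delta' L' (affine1 R m) 0 z' phi'.
Proof.
move=> cphi phiE zE.
have mD := measurable_polytope.
have mphi := continuous_rV_measurable mD cphi.
have mfw D (w : R) : measurable_fun D (fun x => (f x `^ w)^-1).
  apply: measurable_funTS.
  apply: measurableT_comp; first exact: measurable_invr.
  apply: (measurableT_comp (measurable_powR w)).
  exact: measurable_fun_affine.
rewrite /DF_functional mulrBr; congr (_ - _).
  rewrite mulrCA; congr (_ * _); rewrite /boundary_integral mulr_sumr.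
  apply: eq_bigr => i _; rewrite is_twist_facet.
  apply/esym; apply: Rintegral_facet_twist => //.
  - by rewrite {1}is_twist_label.
  - by rewrite {1}is_twist_label.
  - exact: measurable_label_facet.
  - by move=> x [].
  - by move=> x [Dx _]; exact: f_pos.
  - apply: measurable_funM => //.
    by apply: (measurable_funS mD) mphi => x [].
  - move=> x [Dx _]; have fx := f_pos Dx.
    rewrite affine1E powR1 divr1 phiE// (_ : m%:R + 2 - 1 = m%:R + 1%:R + 0%:R).
      rewrite powR_weight ?ltW// exprD exprD expr1 expr0 exprVn.
      by field; rewrite expf_neq0 ?gt_eqF.
    by rewrite addr0; ring.
have [D'E _] := twist; rewrite D'E.
apply/esym; apply: Rintegral_twist => //.
  apply: measurable_funM; first exact: measurable_funM.
  by apply: measurable_funTS; exact: measurable_fun_affine.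
move=> x Dx; have fx := f_pos Dx.
rewrite affine1E powR1 divr1 phiE// zE//.
rewrite (_ : m%:R + 2 + 1 = m%:R + 2%:R + 1%:R)//.
rewrite powR_weight ?ltW// !exprD exprVn !exprS expr0.
by field; rewrite expf_neq0 ?gt_eqF.
Qed.

Lemma DF_zeta_unique z1 z2 :
  (forall phi : affine R m, DF_functional Delta L f (m%:R + 2) z1 phi = 0) ->
  (forall phi : affine R m, DF_functional Delta L f (m%:R + 2) z2 phi = 0) ->
  z1 = z2.
Proof.
move=> Z1 Z2; apply/eqP; rewrite -subr_eq0; apply/eqP.
pose z : affine R m := z1 - z2; rewrite -/z.
have mD := measurable_polytope.
have cD := lp_compact Delta_polytope.
pose h (w : affine R m) x := z x / f x ^+ (m + 2 + 1) * w x.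
have hint w : (lebesgue_rV m).-integrable Delta (EFin \o h w).
  by apply: continuous_compact_rV_integrable => //;
    exact: continuous_affine_quotient.
have hE (w : affine R m) : \int[lebesgue_rV m]_(x in Delta)
    (z x / f x `^ (m%:R + 2 + 1) * w x) =
    \int[lebesgue_rV m]_(x in Delta) h w x.
  apply: eq_Rintegral => x /set_mem Dx.
  rewrite (_ : m%:R + 2 + 1 = m%:R + 2%:R + 1%:R)//.
  by rewrite powR_weight// ltW// f_pos.
have hB x : h z1 x - h z2 x = h z x by rewrite /h -mulrBr -affineB.
have h0 : \int[lebesgue_rV m]_(x in Delta) h z x = 0.
  transitivity (\int[lebesgue_rV m]_(x in Delta) (h z1 x - h z2 x)).
    by apply: eq_Rintegral => x _; rewrite hB.
  rewrite RintegralB//; apply/eqP; rewrite subr_eq0; apply/eqP.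
  (* Tested on [z] itself, the two functionals have the same boundary term, so their volume terms
     agree. *)
  have := Z1 z; rewrite -(Z2 z) /DF_functional => /addrI/oppr_inj.
  by rewrite !hE.
have hge0 x : Delta x -> 0 <= h z x.
  move=> Dx; rewrite /h mulrAC -expr2 divr_ge0 ?sqr_ge0// exprn_ge0//.
  by rewrite ltW// f_pos.
have : ae_eq (lebesgue_rV m) Delta (EFin \o h z) (cst 0%E).
  apply/ae_eq_integral_abs => //.
    by have /integrableP[] := hint z.
  rewrite (eq_integral (EFin \o h z)); last first.
    by move=> x /set_mem Dx; rewrite /= ger0_norm// hge0.
  rewrite -(fineK (integrable_fin_num mD (hint z))).
  by rewrite -[fine _]/(\int[lebesgue_rV m]_(x in Delta) h z x) h0.
move=> [N [mN N0 hN]].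
(* If [z] were non-zero at an interior point, the null set [N] would contain a ball around it, which
   has positive volume. *)
have z0 x : Delta° x -> z x = 0.
  move=> Dx; apply/eqP/negPn/negP => zx.
  have : nbhs x [set y | Delta y /\ z y != 0].
    apply: filterI => //; apply: (@affine_continuous R m z x [set t | t != 0]).
    by apply: open_nbhs_nbhs; split => //; exact: open_neq.
  move=> /nbhs_ballP[e /= e0 eD].
  have : (lebesgue_rV m (ball x e) <= lebesgue_rV m N)%E.
    apply: le_measure; rewrite ?inE//; first exact: measurable_ball_rV.
    move=> y /eD[Dy zy]; apply: hN => /(_ Dy) /= [] /eqP.
    rewrite /h !mulf_eq0 invr_eq0 expf_eq0 (negPf zy) (gt_eqF (f_pos Dy)).
    by rewrite andbF.
  rewrite N0 lebesgue_rV_ball// lee_fin leNgt exprn_gt0//.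
  by rewrite mulr_gt0.
apply: (@affine_eq0 _ _ _ Delta°) => //.
by have [x Dx] := lp_interior Delta_polytope; exists x; exact: nbhs_interior.
Qed.

(** [untwist_affine f] matches the solution sets [Z'] and [Z]. If they are inhabited, [xget] returns
    a solution in each and uniqueness identifies them. *)
Lemma DF_zeta_twist :
  untwist_affine f (DF_zeta1 Delta' L') = DF_zeta Delta L f (m%:R + 2).
Proof.
have f20 := lt0r_neq0 f2.
have DFE z' (phi' : affine R m) :
    DF_functional Delta L f (m%:R + 2) (untwist_affine f z')
      (untwist_affine f phi') =
    f.2^-1 * DF_functional Delta' L' (affine1 R m) 0 z' phi'.
  apply: DF_functional_twist.
  - exact/continuous_subspaceT/affine_continuous.
  - by move=> x Dx; rewrite untwist_affineE// lt0r_neq0// f_pos.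
  - by move=> x Dx; rewrite untwist_affineE// lt0r_neq0// f_pos.
pose Z := [set z | forall phi : affine R m,
  DF_functional Delta L f (m%:R + 2) z phi = 0].
pose Z' := [set z' | forall phi : affine R m,
  DF_functional Delta' L' (affine1 R m) 0 z' phi = 0].
have ZZ' z' : Z (untwist_affine f z') <-> Z' z'.
  split=> Hz phi.
    have := Hz (untwist_affine f phi); rewrite DFE => /eqP.
    by rewrite mulf_eq0 invr_eq0 (negPf f20) => /eqP.
  by rewrite -(twist_affineK phi f20) DFE Hz mulr0.
have [[z Zz]|Z0] := pselect (exists z, Z z).
  have Zzeta : Z (DF_zeta Delta L f (m%:R + 2)).
    exact: (@xgetPex _ 0 Z (ex_intro _ z Zz)).
  have Ztw : Z' (twist_affine f z).
    by apply: (ZZ' _).1; rewrite twist_affineK.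
  have Zzeta' : Z' (DF_zeta1 Delta' L').
    exact: (@xgetPex _ 0 Z' (ex_intro _ _ Ztw)).
  exact: (DF_zeta_unique ((ZZ' _).2 Zzeta') Zzeta).
(* If [Z] is empty then so is [Z']; both choices take the default 0, which [untwist_affine f]
   fixes. *)
have zeta0 : DF_zeta Delta L f (m%:R + 2) = 0.
  by apply: (@xgetPN _ 0 Z) => z Zz; apply: Z0; exists z.
have zeta0' : DF_zeta1 Delta' L' = 0.
  apply: (@xgetPN _ 0 Z') => z' /((ZZ' z').2) Zz'.
  by apply: Z0; exists (untwist_affine f z').
by rewrite zeta0 zeta0' untwist_affine0.
Qed.

End polytope.
End twisted_functional.

Theorem proposition5p11 (R : realType) (m d : nat)
    (Delta : set 'rV[R]_m) (L : 'I_d -> affine R m) (f : affine R m)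
    (Delta' : set 'rV[R]_m) (L' : 'I_d -> affine R m)
    (Delta_polytope : labelled_polytope Delta L)
    (Delta_origin : Delta 0)
    (f_pos : forall x, Delta x -> 0 < f x)
    (twist : is_twist f Delta L Delta' L') :
  (forall phi phi' : 'rV[R]_m -> R,
     {within Delta, continuous phi} ->
     (forall x, Delta x -> phi' (twist_map f x) = phi x / f x) ->
     DF_invariant Delta L f (m%:R + 2) phi
       = 1 / f 0 * DF_invariant1 Delta' L' phi')
  /\ (forall x, Delta x ->
        DF_zeta1 Delta' L' (twist_map f x)
          = DF_zeta Delta L f (m%:R + 2) x / f x).
Proof.
have zetaE x : Delta x -> DF_zeta1 Delta' L' (twist_map f x) =
    DF_zeta Delta L f (m%:R + 2) x / f x.
  move=> /f_pos/lt0r_neq0 fx.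
  rewrite -(DF_zeta_twist Delta_polytope Delta_origin f_pos twist).
  exact: untwist_affineE.
split=> // phi phi' cphi phiE.
rewrite /DF_invariant1 /DF_invariant.
rewrite (DF_functional_twist Delta_polytope Delta_origin f_pos twist cphi phiE
  zetaE) div1r; congr (_^-1 * _).
(* The factor [f.2] from the Jacobians is the value [f 0]. *)
by rewrite /affine_eval big1 ?add0r// => i _; rewrite mxE mulr0.
Qed.
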